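(* Let $M$ be a connected complex manifold with a holomorphic bracket generating distribution $D$. Then for any two points $x, y$ in $M$, one has $d_{M,D}(x,y)<\infty$.
   Context: $T_M$ denotes the holomorphic tangent bundle of $M$. A holomorphic distribution $D$ on $M$ is a holomorphic subbundle of $T_M$. It is bracket generating if any local holomorphic frame $\{X_1,\ldots,X_d\}$ of $D$, together with all of its iterated Lie brackets $[X_i,X_j]$, $[X_i,[X_j,X_\ell]]$, $\ldots$, spans $T_M$. A holomorphic map $f\colon N\to M$ is tangential to $D$ if $df(T_N)\subset D$. Let $\Delta=\{z\in\mathbb{C}:|z|<1\}$ and let $d_\Delta$ be the Poincaré distance on $\Delta$. For $x,y\in M$ put $$\delta_{M,D}(x,y)=\inf\{d_\Delta(a,b): h\colon\Delta\to M \text{ holomorphic, tangential to } D,\ h(a)=x,\ h(b)=y\},$$ with $\delta_{M,D}(x,y)=\infty$ if there is no such disc. The Kobayashi pseudo-distance of $(M,D)$ is $$d_{M,D}(x,y)=\inf\sum_{j=1}^N\delta_{M,D}(x_{j-1},x_j),$$ where the infimum is over finite sets of points $\{x_0,\ldots,x_N\}$ of $M$ with $x_0=x$, $x_N=y$. *)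

(* Defs.v *)
From HB Require Import structures.
From mathcomp Require Import all_boot all_order all_algebra.
From mathcomp Require Import complex.
From mathcomp Require Import all_classical all_reals all_analysis.

Set Implicit Arguments.
Unset Strict Implicit.
Unset Printing Implicit Defensive.

Import Order.TTheory GRing.Theory Num.Theory.
Import numFieldNormedType.Exports.

Local Open Scope classical_set_scope.
Local Open Scope ring_scope.

(* MathComp-Analysis puts a topology and a normed-module structure on the
   carrier of any numClosedFieldType; it is found by unification for [Cx R],
   but not for the raw type [R[i]]. *)
Definition Cx (R : realType) : numClosedFieldType := R[i].

(* The linear span of a set of vectors; it contains 0 (take m = 0). *)
Definition lspan (K : fieldType) (V : lmodType K) (A : set V) : set V :=
  [set v | exists (m : nat) (a : 'I_m -> K) (w : 'I_m -> V),
     (forall j, A (w j)) /\ v = \sum_(j < m) a j *: w j].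

Definition lin_independent (K : fieldType) (V : lmodType K) (d : nat)
    (w : 'I_d -> V) : Prop :=
  forall a : 'I_d -> K, \sum_(j < d) a j *: w j = 0 -> forall j, a j = 0.

(* A chart is a homeomorphism from the open set [chart_dom] onto an open set of
   C^n. The maps are total functions; their values off [chart_dom] and off its
   image are irrelevant. *)
Record chart (R : realType) (n : nat) (M : topologicalType) := Chart {
  chart_dom : set M;
  chart_map :> M -> 'rV[Cx R]_n;
  chart_inv : 'rV[Cx R]_n -> M;
  chart_dom_open : open chart_dom;
  chart_image_open : open (chart_map @` chart_dom);
  chart_mapK : forall p, chart_dom p -> chart_inv (chart_map p) = p;
  chart_map_continuous : forall p, chart_dom p ->
    {for p, continuous chart_map};
  chart_inv_continuous : forall p, chart_dom p ->
    {for chart_map p, continuous chart_inv} }.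

(* [differentiable] is Frechet differentiability over the scalar field [Cx R],
   that is, complex differentiability. Here and below a map is holomorphic on an
   open set when it is complex differentiable at each point of it; in
   [transition_holomorphic] the open set is the image under chart i of the
   overlap of the domains of charts i and j. *)
Record complexManifold (R : realType) (n : nat) := ComplexManifold {
  manifold_space :> topologicalType;
  manifold_hausdorff : hausdorff_space manifold_space;
  manifold_second_countable : @second_countable manifold_space;
  chart_index : Type;
  atlas : chart_index -> chart R n manifold_space;
  atlas_cover : forall p, exists i, chart_dom (atlas i) p;
  transition_holomorphic : forall i j p,
    chart_dom (atlas i) p -> chart_dom (atlas j) p ->
    differentiable (atlas j \o chart_inv (atlas i)) (atlas i p) }.

Section Distributions.
Variables (R : realType) (n : nat) (M : complexManifold R n).

Local Notation dom i := (chart_dom (atlas (c := M) i)).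
Local Notation phi i := (atlas (c := M) i).
Local Notation psi i := (chart_inv (atlas (c := M) i)).

(* A holomorphic tangent vector at p is given by its coordinates in all charts
   around p, which must be related by the differentials of the transition maps.
   The coordinates in the other charts are set to 0, so that [tangent_space p]
   is a linear subspace of [tvec], and any single chart at p identifies it with
   C^n. *)
Definition tvec : lmodType (Cx R) := chart_index M -> 'rV[Cx R]_n.

Definition tangent_space (p : M) : set tvec :=
  [set v | (forall i j, dom i p -> dom j p ->
              v j = 'd (phi j \o psi i) (phi i p) (v i)) /\
           (forall i, ~ dom i p -> v i = 0)].

(* Vector fields are total functions, looked at only on an open set U. *)
Definition vfield : Type := M -> tvec.

Definition vfield_in_chart (X : vfield) (i : chart_index M)
    (z : 'rV[Cx R]_n) : 'rV[Cx R]_n := X (psi i z) i.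

Definition holomorphic_vfield (U : set M) (X : vfield) : Prop :=
  forall p, U p -> tangent_space p (X p) /\
    forall i, dom i p -> differentiable (vfield_in_chart X i) (phi i p).

(* [X, Y] = dY(X) - dX(Y) in each chart. *)
Definition lie_bracket (X Y : vfield) : vfield := fun p i =>
  if p \in dom i then
    'd (vfield_in_chart Y i) (phi i p) (X p i) -
    'd (vfield_in_chart X i) (phi i p) (Y p i)
  else 0.

Inductive iterated_bracket (d : nat) (X : 'I_d -> vfield) : vfield -> Prop :=
| iterated_bracket_gen j : iterated_bracket X (X j)
| iterated_bracket_lie Y Z :
    iterated_bracket X Y -> iterated_bracket X Z ->
    iterated_bracket X (lie_bracket Y Z).

Definition holomorphic_frame (d : nat) (D : M -> set tvec) (U : set M)
    (X : 'I_d -> vfield) : Prop :=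
  [/\ open U,
      forall j, holomorphic_vfield U (X j),
      forall p, U p -> lin_independent (fun j => X j p) &
      forall p, U p -> D p = lspan (range (fun j => X j p))].

(* A holomorphic subbundle of the tangent bundle, of rank [dist_rank]. *)
Record holoDistribution := HoloDistribution {
  dist_rank : nat;
  dist_fiber :> M -> set tvec;
  dist_frame : forall p, exists (U : set M) (X : 'I_dist_rank -> vfield),
    U p /\ holomorphic_frame dist_fiber U X }.

Definition bracket_generating (D : holoDistribution) : Prop :=
  forall (U : set M) (X : 'I_(dist_rank D) -> vfield),
    holomorphic_frame D U X ->
    forall p, U p ->
      tangent_space p `<=` lspan [set Y p | Y in iterated_bracket X].

Definition unit_disc : set (Cx R) := [set z | `|z| < 1].

(* The distance of the metric 4|dz|^2 / (1 - |z|^2)^2 of curvature -1. *)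
Definition poincare_dist (a b : Cx R) : R :=
  let t := ComplexField.Normc.normc ((a - b) / (1 - b^* * a) : R[i]) in
  ln ((1 + t) / (1 - t)).

(* Discs are total functions, looked at only on [unit_disc]. *)
Definition holomorphic_disc (h : Cx R -> M) : Prop :=
  forall z, unit_disc z -> {for z, continuous h} /\
    forall i, dom i (h z) -> differentiable (phi i \o h) z.

Definition disc_differential (h : Cx R -> M) (z w : Cx R) : tvec := fun i =>
  if h z \in dom i then 'd (phi i \o h) z w else 0.

Definition tangential_disc (D : holoDistribution) (h : Cx R -> M) : Prop :=
  forall z, unit_disc z -> forall w, D (h z) (disc_differential h z w).

(* [ereal_inf] of the empty set is +oo. *)
Definition disc_dist (D : holoDistribution) (x y : M) : \bar R :=
  ereal_inf [set r | exists (a b : Cx R) (h : Cx R -> M),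
    [/\ unit_disc a /\ unit_disc b,
        holomorphic_disc h /\ tangential_disc D h,
        h a = x, h b = y & r = (poincare_dist a b)%:E]].

Definition kobayashi_dist (D : holoDistribution) (x y : M) : \bar R :=
  ereal_inf [set r | exists (N : nat) (u : nat -> M),
    [/\ u 0%N = x, u N = y &
        r = (\sum_(0 <= j < N) disc_dist D (u j) (u j.+1))%E]].

End Distributions.

(* Main.v *)
Require Import Defs.
From HB Require Import structures.
From mathcomp Require Import all_boot all_order all_algebra.
From mathcomp Require Import complex.
From mathcomp Require Import all_classical all_reals all_analysis.
From mathcomp Require Import ring lra.

Set Implicit Arguments.
Unset Strict Implicit.
Unset Printing Implicit Defensive.

Import Order.TTheory GRing.Theory Num.Theory.
Import numFieldNormedType.Exports.

Local Open Scope classical_set_scope.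
Local Open Scope ring_scope.

(** Two points of a tangential disc are at finite distance, so it is enough to
join any two points of M by a finite chain of tangential discs. Being joined by
a chain is an equivalence relation, and M is connected; hence it is enough that
the class of a point p is a neighbourhood of p ([chain_near]). This is a
holomorphic form of the theorem of Chow and Rashevskii, and it is proved in a
chart ([local_chow]).

The heart of it is a rank argument. Consider the holomorphic maps Th from a
neighbourhood of a point of C^k to the chart, with injective differential, all
of whose values can be reached from p, and let k be maximal. Flowing along a
field X_j of the frame, from the points Th s, adds one parameter and would give
an injective differential in k + 1 variables if X_j were not tangent to the
image of Th ([attained_extend]); so all X_j are tangent to it. If Y and Z are
tangent, Y (Th s) = dTh_s (y s) and Z (Th s) = dTh_s (z s), then differentiating
the first identity along z, the second along y, and subtracting, the second
derivatives of Th cancel by symmetry and [Z, Y] is tangent as well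
([tangent_derivative], [bracket_tangent]). As the iterated brackets span, dTh is
onto, Th is open ([open_mapping]), and its image contains an open set of
reachable points. To get from this open set back to p, [reachable] asks for more
than membership in the class of p: q must be the value at p of a map that is
continuous at p and moves no point near p out of its class. Such a map carries a
neighbourhood of p into the open set, so the neighbourhood lies in one class.

The fields are only supposed to be complex differentiable at each point, so
the regularity of holomorphic maps has to be established first: their
derivatives are Lipschitz ([cauchy_diff_lipschitz]), uniform limits are
holomorphic ([weierstrass]), derivatives are holomorphic ([diff_dir]) and second
derivatives are symmetric ([diff_sym]). All of this follows from the Cauchy
estimate |g'(0)| <= 6 M / rho for a function bounded by M on the disc of radius
rho ([cauchy_estimate0]), applied to differences of translates. The estimate
rests on Goursat's theorem, which is proved here for finite midpoint sums
[msum] in place of integrals: these sums are exactly additive under halving,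
odd under reversal of the segment and exact for affine functions, which is all
that the bisection of a triangle uses ([goursat]). The same sums solve the
differential equation of a holomorphic field by Picard iteration; the iterates
are holomorphic in time and initial point jointly, and so is their uniform limit
([local_flow]). *)

(** * Real-valued norms *)
Section Norm.
Variable R : realType.
Implicit Types V W : normedModType (Cx R).

(** The norm of a normed module over C takes its values in C, which is only
partially ordered; estimates are carried out with this real number instead. *)
Definition nrm V (x : V) : R := complex.Re (`|x| : R[i]).

Definition toC (r : R) : Cx R := (r%:C)%C.

Lemma nrmE V (x : V) : `|x| = toC (nrm x).
Proof. by rewrite /toC /nrm RRe_real // ger0_real. Qed.

Lemma toC_le r s : (toC r <= toC s) = (r <= s).
Proof. exact: lecR. Qed.

Lemma toC_lt r s : (toC r < toC s) = (r < s).
Proof. exact: ltcR. Qed.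

Lemma toC_pos (e : Cx R) : 0 < e -> exists2 r : R, 0 < r & e = toC r.
Proof.
move=> e0; have E : e = toC (complex.Re (e : R[i])).
  by rewrite /toC RRe_real // gtr0_real.
by exists (complex.Re (e : R[i])); rewrite // -toC_lt -E.
Qed.

Lemma toCM r s : toC (r * s) = toC r * toC s.
Proof. exact: rmorphM. Qed.
Lemma toCD r s : toC (r + s) = toC r + toC s.
Proof. exact: rmorphD. Qed.
Lemma toCN r : toC (- r) = - toC r.
Proof. exact: rmorphN. Qed.
Lemma toCV r : toC (r^-1) = (toC r)^-1.
Proof. exact: (fmorphV (real_complex R)). Qed.
Lemma toC_eq0 r : (toC r == 0) = (r == 0).
Proof. exact: (fmorph_eq0 (real_complex R)). Qed.
Lemma toC_inj : injective toC.
Proof. by move=> r s /(congr1 (fun z : R[i] => complex.Re z)). Qed.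
Lemma toC1 : toC 1 = 1. Proof. by []. Qed.
Lemma toC_nat n : toC n%:R = n%:R.
Proof. exact: (rmorph_nat (real_complex R)). Qed.

Lemma nrm_ge0 V (x : V) : 0 <= nrm x.
Proof. by rewrite -toC_le -nrmE; exact: normr_ge0. Qed.

Lemma nrm0 V : nrm (0 : V) = 0.
Proof. by apply: toC_inj; rewrite -nrmE normr0. Qed.

Lemma nrm_eq0 V (x : V) : nrm x = 0 -> x = 0.
Proof. by move=> h; apply/eqP; rewrite -normr_eq0 nrmE h. Qed.

Lemma nrm_gt0 V (x : V) : x != 0 -> 0 < nrm x.
Proof. by move=> h; rewrite -toC_lt -nrmE normr_gt0. Qed.

Lemma nrmD V (x y : V) : nrm (x + y) <= nrm x + nrm y.
Proof. by rewrite -toC_le toCD -!nrmE ler_normD. Qed.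

Lemma nrmN V (x : V) : nrm (- x) = nrm x.
Proof. by rewrite /nrm normrN. Qed.

Lemma nrmB V (x y : V) : nrm (x - y) <= nrm x + nrm y.
Proof. by rewrite -(nrmN y) nrmD. Qed.

Lemma nrmBC V (x y : V) : nrm (x - y) = nrm (y - x).
Proof. by rewrite -nrmN opprB. Qed.

Lemma nrm_tri V (x y z : V) : nrm (x - z) <= nrm (x - y) + nrm (y - z).
Proof. by rewrite -[x in leLHS](subrK y) -addrA nrmD. Qed.

Lemma nrm_trir V (x y : V) : nrm x <= nrm y + nrm (x - y).
Proof. by rewrite -[x in leLHS](subrK y) addrC nrmD. Qed.

Lemma nrmZ V (a : Cx R) (x : V) : nrm (a *: x) = nrm a * nrm x.
Proof. by apply: toC_inj; rewrite toCM -!nrmE normrZ. Qed.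

Lemma nrmM (a b : Cx R) : nrm (a * b) = nrm a * nrm b.
Proof. exact: nrmZ. Qed.

Lemma nrm1 : nrm (1 : Cx R) = 1.
Proof. by apply: toC_inj; rewrite -nrmE normr1. Qed.

Lemma nrmV (a : Cx R) : nrm (a^-1) = (nrm a)^-1.
Proof. by apply: toC_inj; rewrite toCV -!nrmE normfV. Qed.

Lemma norm_toC r : `|toC r| = toC `|r|.
Proof. by rewrite /toC normc_def /= expr0n /= addr0 sqrtr_sqr. Qed.

Lemma nrm_toC r : nrm (toC r) = `|r|.
Proof. by apply: toC_inj; rewrite -nrmE; exact: (norm_toC r). Qed.

Lemma nrm_nat n : nrm (n%:R : Cx R) = n%:R.
Proof. by rewrite -toC_nat nrm_toC ger0_norm. Qed.

Lemma nrm_sum V (I : Type) (r : seq I) (P : pred I) (F : I -> V) :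
  nrm (\sum_(i <- r | P i) F i) <= \sum_(i <- r | P i) nrm (F i).
Proof.
elim/big_rec2: _ => [|i a b _ h]; first by rewrite nrm0.
by rewrite (le_trans (nrmD _ _)) // lerD2l.
Qed.

Lemma nbhs_nrm V (x : V) (A : set V) :
  nbhs x A <-> exists2 e, 0 < e & forall y, nrm (y - x) < e -> A y.
Proof.
split.
  move=> /nbhs_normP[e /= /toC_pos[r r0 ->] h]; exists r => // y hy.
  by apply: h; rewrite /= distrC nrmE toC_lt.
move=> [e e0 h]; apply/nbhs_normP; exists (toC e); first by rewrite /= toC_lt.
by move=> y /=; rewrite distrC nrmE toC_lt => /h.
Qed.

Lemma cont_nrm V W (f : V -> W) x : {for x, continuous f} <->
  forall e, 0 < e -> exists2 d, 0 < d & forall y, nrm (y - x) < d ->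
    nrm (f y - f x) < e.
Proof.
split=> h.
  move=> e e0; apply/nbhs_nrm; apply: (h [set z | nrm (z - f x) < e]).
  by apply/nbhs_nrm; exists e.
move=> A /nbhs_nrm[e e0 hA]; have [d d0 hd] := h _ e0.
by apply/nbhs_nrm; exists d => // y /hd /hA.
Qed.

Lemma linear_bound V W (L : {linear V -> W}) : continuous L ->
  exists2 C, 0 < C & forall x, nrm (L x) <= C * nrm x.
Proof.
move=> /linear_lipschitz[k /toC_pos[r r0 ->] h]; exists r => // x.
by rewrite -toC_le toCM -!nrmE.
Qed.

Lemma bound_continuous V W (L : {linear V -> W}) C :
  (forall x, nrm (L x) <= C * nrm x) -> continuous L.
Proof.
move=> h x; apply/cont_nrm => e e0.
exists (e / (`|C| + 1)); first by rewrite divr_gt0 // ltr_wpDl.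
move=> y; rewrite ltr_pdivlMr ?ltr_wpDl // => hy.
rewrite -linearB; apply: le_lt_trans (h _) (le_lt_trans _ hy).
rewrite mulrC ler_wpM2l ?nrm_ge0 //.
by rewrite (le_trans (ler_norm _)) // lerDl.
Qed.

(** The two directions between differentiability and the epsilon-delta form of the
first-order expansion. *)
Lemma diff_nrm V W (f : V -> W) x : differentiable f x ->
  forall e, 0 < e -> exists2 d, 0 < d & forall y, nrm (y - x) < d ->
    nrm (f y - f x - 'd f x (y - x)) <= e * nrm (y - x).
Proof.
move=> /diff_locallyP[_ /eqaddoP h] e e0.
have /h : 0 < toC e by rewrite toC_lt.
move=> /nbhs_nrm[d d0 hd]; exists d => // y hy.
have := hd (y - x); rewrite subr0 => /(_ hy) /=.
by rewrite !nrmE -toCM toC_le /= !fctE /= subrK opprD addrA.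
Qed.

Lemma nrm_diff V W (f : V -> W) x (L : {linear V -> W}) : continuous L ->
  (forall e, 0 < e -> exists2 d, 0 < d & forall y, nrm (y - x) < d ->
    nrm (f y - f x - L (y - x)) <= e * nrm (y - x)) ->
  differentiable f x /\ 'd f x = L :> (V -> W).
Proof.
move=> cL h.
have o : f \o shift x = cst (f x) + L +o_ 0 id.
  apply/eqaddoP => e /toC_pos[r r0 ->]; have [d d0 hd] := h _ r0.
  apply/nbhs_nrm; exists d => // y; rewrite subr0 => hy.
  have := hd (y + x); rewrite addrK => /(_ hy).
  by rewrite !nrmE -toCM toC_le /= !fctE /= opprD addrA.
have E := diff_unique cL o.
by split => //; apply/diff_locallyP; rewrite E.
Qed.

(** Differentials only depend on germs. *)
Lemma nrm_diff_ext V W (f g : V -> W) x : (\forall y \near x, f y = g y) ->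
  differentiable f x -> differentiable g x /\ 'd g x = 'd f x :> (V -> W).
Proof.
move=> /nbhs_nrm[d d0 hd] df; apply: nrm_diff.
  exact: diff_continuous.
move=> e /(diff_nrm df)[d' d'0 hd'].
exists (Num.min d d'); first by rewrite lt_min d0.
move=> y; rewrite lt_min => /andP[y1 y2].
by rewrite -!hd ?hd' // subrr nrm0.
Qed.

Definition tends V (u : nat -> V) (l : V) :=
  forall e, 0 < e -> exists N, forall k, (N <= k)%N -> nrm (u k - l) <= e.

Definition cauchyS V (u : nat -> V) := forall e, 0 < e ->
  exists N, forall k l, (N <= k)%N -> (N <= l)%N -> nrm (u k - u l) <= e.

End Norm.

(** * Completeness and bisection *)
Section Complete.
Variable R : realType.
Implicit Types V W : normedModType (Cx R).

Lemma le0_eps (x : R) : (forall e, 0 < e -> x <= e) -> x <= 0.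
Proof. by move=> h; apply/ler_addgt0Pr => e /h; rewrite add0r. Qed.

(** Proofs of inequalities with an arbitrarily small error end here; C collects
the constants met on the way. *)
Lemma le_eps (x y C : R) : (forall e, 0 < e -> x <= y + C * e) -> x <= y.
Proof.
move=> h; rewrite -subr_le0; apply: le0_eps => e e0.
have C0 : 0 < `|C| + 1 by rewrite ltr_wpDl.
have := h (e / (`|C| + 1)); rewrite divr_gt0 // => /(_ isT).
rewrite -lerBlDl => /le_trans; apply.
rewrite mulrCA; apply: ler_piMr; rewrite ?(ltW e0) // ler_pdivrMr // mul1r.
by rewrite (le_trans (ler_norm _)) // lerDl.
Qed.

Lemma expr_half_gt0 k : 0 < (2^-1 : R) ^+ k.
Proof. by rewrite exprn_gt0 // invr_gt0. Qed.

Lemma expr_half_ge0 k : 0 <= (2^-1 : R) ^+ k.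
Proof. exact: ltW (expr_half_gt0 k). Qed.

Lemma expr_half_le1 k : (2^-1 : R) ^+ k <= 1.
Proof. by rewrite exprn_ile1 // ?invr_ge0 // invf_le1 // ler1n. Qed.

Lemma expr_half_small (e C : R) : 0 < e ->
  exists N, forall k, (N <= k)%N -> C * 2^-1 ^+ k <= e.
Proof.
move=> e0; have C0 : 0 < `|C| + 1 by rewrite ltr_wpDl.
have h0 : (fun n : nat => (2^-1 : R) ^+ n) @ \oo --> (0 : R).
  by apply: cvg_expr; rewrite ger0_norm ?invf_lt1 ?ltr1n // invr_ge0.
have /cvgrPdist_lt/(_ (e / (`|C| + 1))) := h0.
rewrite divr_gt0 // => /(_ isT)[N _ hN]; exists N => k /hN /=.
rewrite sub0r normrN ger0_norm ?expr_half_ge0 // ltr_pdivlMr // mulrC => h.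
apply: le_trans (ltW h); rewrite ler_wpM2r ?expr_half_ge0 //.
by rewrite (le_trans (ler_norm _)) // lerDl.
Qed.

Definition complete_nrm V := forall u : nat -> V, cauchyS u -> exists l, tends u l.

Lemma nrm_Re (z : Cx R) : `|complex.Re (z : R[i])| <= nrm z.
Proof. by rewrite -toC_le -nrmE; exact: normc_ge_Re. Qed.

(** Multiplication by i reduces this to the real part. *)
Lemma nrm_Im (z : Cx R) : `|complex.Im (z : R[i])| <= nrm z.
Proof.
have -> : complex.Im (z : R[i]) = - complex.Re ('i%C * (z : R[i]))%C.
  by case: z => a b /=; rewrite mul0r mul1r sub0r opprK.
rewrite normrN (le_trans (nrm_Re _)) // (nrmM ('i%C : R[i])).
suff -> : nrm ('i%C : Cx R) = 1 by rewrite mul1r.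
by apply: toC_inj; rewrite -nrmE normc_def /= expr0n expr1n add0r sqrtr1.
Qed.

Lemma nrm_ReIm (z : Cx R) :
  nrm z <= `|complex.Re (z : R[i])| + `|complex.Im (z : R[i])|.
Proof.
have E : z = toC (complex.Re (z : R[i])) + ('i%C : R[i]) * toC (complex.Im (z : R[i])).
  by case: z => a b; rewrite /toC /=; simpc.
rewrite {1}E (le_trans (nrmD _ _)) // nrm_toC lerD2l (nrmM ('i%C : R[i])) nrm_toC.
suff -> : nrm ('i%C : Cx R) = 1 by rewrite mul1r.
by apply: toC_inj; rewrite -nrmE normc_def /= expr0n expr1n add0r sqrtr1.
Qed.

Lemma complete_real (u : nat -> R) :
  (forall e, 0 < e -> exists N, forall k l, (N <= k)%N -> (N <= l)%N ->
     `|u k - u l| <= e) ->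
  exists l, forall e, 0 < e -> exists N, forall k, (N <= k)%N -> `|u k - l| <= e.
Proof.
move=> h; have /cauchy_cvgP : cauchy (u @ \oo).
  apply: cauchy_exP => e e0; have [N hN] := h _ (divr_gt0 e0 (ltr0Sn _ 1)).
  exists (u N); exists N => // k /= Nk; rewrite /ball /=.
  by rewrite (le_lt_trans (hN _ _ _ _)) // ltr_pdivrMr // ltr_pMr // ltr1n.
move=> /cvgrPdist_le c; exists (lim (u @ \oo)) => e /c[N _ hN].
by exists N => k /hN; rewrite /= distrC.
Qed.

Lemma complete_Cx : complete_nrm (Cx R).
Proof.
move=> u cu.
have [a ha] : exists a, forall e, 0 < e -> exists N, forall k, (N <= k)%N ->
   `|complex.Re (u k : R[i]) - a| <= e.
  apply: complete_real => e /cu[N hN]; exists N => k l Nk Nl.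
  apply: le_trans (hN _ _ Nk Nl); apply: le_trans (nrm_Re _).
  by rewrite (raddfB (@complex.Re R)).
have [b hb] : exists b, forall e, 0 < e -> exists N, forall k, (N <= k)%N ->
   `|complex.Im (u k : R[i]) - b| <= e.
  apply: complete_real => e /cu[N hN]; exists N => k l Nk Nl.
  apply: le_trans (hN _ _ Nk Nl); apply: le_trans (nrm_Im _).
  by rewrite (raddfB (@complex.Im R)).
exists ((a +i* b)%C : R[i]) => e e0.
have [N hN] := ha _ (divr_gt0 e0 (ltr0Sn _ 1)).
have [N' hN'] := hb _ (divr_gt0 e0 (ltr0Sn _ 1)).
exists (maxn N N') => k; rewrite geq_max => /andP[/hN h1 /hN' h2].
apply: le_trans (nrm_ReIm _) _.
rewrite (raddfB (@complex.Re R)) (raddfB (@complex.Im R)) /=; lra.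
Qed.

Lemma nrm_coord n (x : 'rV[Cx R]_n) i : nrm (x 0 i) <= nrm x.
Proof.
rewrite -toC_le -!nrmE [leRHS]/Num.norm /= mx_normE.
rewrite -[leLHS]nngE num_le.
exact: (le_bigmax _ (fun i : 'I_1 * 'I_n => `|x i.1 i.2|%:nng) (0, i)).
Qed.

(** Only the equivalence of norms matters, so the constant is a crude one. *)
Lemma nrm_row n (x : 'rV[Cx R]_n) : nrm x <= (\sum_i nrm (x 0 i)) * (\sum_i nrm (delta_mx 0
    i : 'rV[Cx R]_n)).
Proof.
rewrite [x in nrm x]row_sum_delta; apply: le_trans (nrm_sum _ _ _) _.
rewrite mulr_suml; apply: ler_sum => i _; rewrite nrmZ ler_wpM2l ?nrm_ge0 //.
by rewrite (bigD1 i) //= lerDl sumr_ge0 // => *; rewrite nrm_ge0.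
Qed.

Lemma complete_row n : complete_nrm 'rV[Cx R]_n.
Proof.
move=> u cu; have H i : exists l, tends (fun k => u k 0 i) l.
  apply: complete_Cx => e /cu[N hN]; exists N => k l Nk Nl.
  apply: le_trans (hN _ _ Nk Nl); apply: le_trans (nrm_coord _ i).
  by rewrite !mxE.
have [l hl] := choice H.
exists (\row_i l i) => e e0.
set S := \sum_i nrm (delta_mx 0 i : 'rV[Cx R]_n).
have S0 : 0 <= S by apply: sumr_ge0 => *; apply: nrm_ge0.
have d0 : 0 < e / ((S + 1) * (n%:R + 1)).
  by rewrite divr_gt0 // mulr_gt0 // ltr_wpDl.
have [N hN] := choice (fun i => hl i _ d0).
exists (\max_i N i) => k hk; apply: le_trans (nrm_row _) _.
have {}hN i : nrm ((u k - \row_i l i) 0 i) <= e / ((S + 1) * (n%:R + 1)).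
  by rewrite !mxE; apply: hN; apply: leq_trans hk; rewrite leq_bigmax.
apply: (@le_trans _ _ ((\sum_(i < n) (e / ((S + 1) * (n%:R + 1)))) * S)).
  by rewrite ler_wpM2r // ler_sum.
rewrite sumr_const card_ord -[X in X * S <= _]mulr_natl.
have n0 : 0 <= n%:R :> R by [].
have qE : e / ((S + 1) * (n%:R + 1)) * ((S + 1) * (n%:R + 1)) = e.
  by rewrite divfK // mulf_neq0 // gt_eqF // ltr_wpDl.
move: (e / _) d0 qE => q q0 {1}<-.
move: (n%:R) n0 (S) S0 => r r0 {hN}S S0.
have := mulr_ge0 (ltW q0) S0; have := mulr_ge0 (ltW q0) r0 => *; lra.
Qed.

(** The successive steps are dominated by a geometric series of ratio 1/2. *)
Lemma geo_lim V (u : nat -> V) D : complete_nrm V ->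
  (forall k, nrm (u k.+1 - u k) <= D * 2^-1 ^+ k) ->
  exists l, forall k, nrm (u k - l) <= 2 * D * 2^-1 ^+ k.
Proof.
move=> cV h.
have D0 : 0 <= D by have := h 0%N; rewrite expr0 mulr1; apply/le_trans/nrm_ge0.
have H k m : nrm (u (k + m)%N - u k) <= 2 * D * (2^-1 ^+ k - 2^-1 ^+ (k + m)).
  elim: m => [|m IH]; first by rewrite addn0 !subrr nrm0 mulr0.
  rewrite addnS; apply: le_trans (nrm_tri _ (u (k + m)%N) _) _.
  have := h (k + m)%N; rewrite exprS.
  move: (2^-1 ^+ k) (2^-1 ^+ (k + m)) IH => a b; lra.
have H2 k m : (k <= m)%N -> nrm (u m - u k) <= 2 * D * 2^-1 ^+ k.
  move=> km; rewrite -(subnKC km); apply: le_trans (H _ _) _.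
  rewrite ler_wpM2l ?mulr_ge0 // gerBl expr_half_ge0 //.
have [|l hl] := cV u.
  move=> e e0; have [N hN] := expr_half_small (4 * D) e0; exists N => k l Nk Nl.
  apply: le_trans (nrm_tri _ (u N) _) _; rewrite (nrmBC (u N)).
  have := H2 _ _ Nk; have := H2 _ _ Nl; have := hN _ (leqnn N); lra.
exists l => k; apply: (@le_eps _ _ 1) => e /hl[N hN].
apply: le_trans (nrm_tri _ (u (maxn k N)) _) _; rewrite nrmBC mul1r lerD //.
  by apply: H2; rewrite leq_maxl.
by apply: hN; rewrite leq_maxr.
Qed.

(** Compactness argument shared by Goursat's theorem and the mean value
inequality: a configuration that violates an estimate at scale 2^-l contains one
that violates it at scale 2^-(l+1), and the configurations shrink to a point. *)
Lemma bisection (T : Type) (Bad : nat -> T -> Prop) (pos : T -> Cx R) (D : R) t0 :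
  Bad 0%N t0 ->
  (forall l t, Bad l t -> exists2 t', Bad l.+1 t' &
     nrm (pos t' - pos t) <= D * 2^-1 ^+ l) ->
  exists c, exists s : nat -> T, forall l, Bad l (s l) /\
     nrm (pos (s l) - c) <= 2 * D * 2^-1 ^+ l.
Proof.
move=> B0 Bs.
pose Q (x y : {x : nat * T | Bad x.1 x.2}) := (sval y).1 = (sval x).1.+1 /\
   nrm (pos (sval y).2 - pos (sval x).2) <= D * 2^-1 ^+ (sval x).1.
have QQ x : {y | Q x y}.
  apply: cid; case: x => -[l t] /= B; have [t' B' h] := Bs _ _ B.
  by exists (exist _ (l.+1, t') B').
have [f [f0 fS]] := dependent_choice QQ (exist _ (0%N, t0) B0).
have fl l : (sval (f l)).1 = l by elim: l => [|l IH]; [rewrite f0 | rewrite (fS l).1 IH].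
have [|c hc] := @geo_lim _ (fun l => pos (sval (f l)).2) D complete_Cx.
  by move=> l; have := (fS l).2; rewrite fl.
exists c, (fun l => (sval (f l)).2) => l; split=> //.
by have := svalP (f l); rewrite fl.
Qed.

End Complete.

(** * Midpoint sums along segments *)
Section Midpoint.
Variable R : realType.
Implicit Types V W : normedModType (Cx R).
Local Notation C := (Cx R).

Definition mid (a b : C) : C := (a + b) / 2.

Lemma midC a b : mid a b = mid b a.
Proof. by rewrite /mid addrC. Qed.

Lemma nrm_half (z : C) : nrm (z / 2) = nrm z / 2.
Proof. by rewrite nrmM nrmV (nrm_nat R 2). Qed.

Lemma mid_subl a b : mid a b - a = (b - a) / 2.
Proof. by rewrite /mid; field. Qed.

Lemma mid_subr a b : b - mid a b = (b - a) / 2.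
Proof. by rewrite /mid; field. Qed.

Definition mid_closed (K : set C) := forall a b, K a -> K b -> K (mid a b).

(** Closedness in the form in which limits of bisections use it. *)
Definition seq_closed (K : set C) :=
  forall c, (forall e, 0 < e -> exists2 z, K z & nrm (z - c) <= e) -> K c.

Lemma mid_closed_ball (c : C) r : mid_closed [set z | nrm (z - c) <= r].
Proof.
move=> a b /= ha hb; have -> : mid a b - c = ((a - c) + (b - c)) / 2.
  by rewrite /mid; field.
by rewrite nrm_half ler_pdivrMr // (le_trans (nrmD _ _)) //; lra.
Qed.

(** The midpoint rule for the integral of f dz over the segment [a, b], with 2^k
subintervals. The midpoint, rather than an endpoint, makes the sum odd under
reversal and exact for affine functions. *)
Fixpoint msum V (f : C -> V) k (a b : C) : V :=
  if k is k'.+1 then msum f k' a (mid a b) + msum f k' (mid a b) b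
  else (b - a) *: f (mid a b).

Section Msum.
Variable V : normedModType (Cx R).
Implicit Types (f g : C -> V).

Lemma msum_sym f k a b : msum f k b a = - msum f k a b.
Proof.
elim: k a b => [|k IH] a b /=; first by rewrite midC -scaleNr opprB.
by rewrite (midC b a) IH (IH a) addrC -opprD.
Qed.

Lemma msumB f g k a b : msum (fun z => f z - g z) k a b = msum f k a b - msum g k a b.
Proof.
by elim: k a b => [|k IH] a b /=; rewrite ?scalerBr // !IH opprD addrACA.
Qed.

Lemma msum_affine (u v : V) k a b :
  msum (fun z => u + z *: v) k a b = (b - a) *: u + ((b ^+ 2 - a ^+ 2) / 2) *: v.
Proof.
elim: k a b => [|k IH] a b /=.
  rewrite scalerDr scalerA; congr (_ + _ *: _); rewrite /mid; by field.
rewrite !IH addrACA -(scalerDl u) -(scalerDl v); congr (_ *: _ + _ *: _); rewrite /mid; by field.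
Qed.

Lemma msum_bound f K M k a b : mid_closed K -> (forall z, K z -> nrm (f z) <= M) ->
  K a -> K b -> nrm (msum f k a b) <= M * nrm (b - a).
Proof.
move=> Km hf; elim: k a b => [|k IH] a b Ka Kb /=.
  by rewrite nrmZ mulrC ler_wpM2r ?nrm_ge0 // hf //; apply: Km.
have Kc := Km _ _ Ka Kb.
apply: le_trans (nrmD _ _) _; apply: le_trans (lerD (IH _ _ Ka Kc) (IH _ _ Kc Kb)) _.
rewrite mid_subl mid_subr nrm_half; lra.
Qed.

(** For a Lipschitz function the midpoint sums converge at a geometric rate. *)
Lemma msum_refine f K L k a b : mid_closed K ->
  (forall z w, K z -> K w -> nrm (f z - f w) <= L * nrm (z - w)) -> 0 <= L ->
  K a -> K b ->
  nrm (msum f k.+1 a b - msum f k a b) <= L * nrm (b - a) ^+ 2 * 2^-1 ^+ k.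
Proof.
move=> Km hf L0; elim: k a b => [|k IH] a b Ka Kb.
  have Kc := Km _ _ Ka Kb; have Kac := Km _ _ Ka Kc; have Kcb := Km _ _ Kc Kb.
  rewrite /= mid_subl mid_subr.
  have -> : (b - a) *: f (mid a b) = ((b - a) / 2) *: f (mid a b) + ((b - a) / 2) *: f (mid a b).
    by rewrite -scalerDl; congr (_ *: _); field.
  rewrite opprD addrACA -!scalerBr.
  apply: le_trans (nrmD _ _) _; rewrite 2!(nrmZ (_ / 2)) !nrm_half.
  have h1 := hf _ _ Kac Kc; have h2 := hf _ _ Kcb Kc.
  have E1 : nrm (mid a (mid a b) - mid a b) = nrm (b - a) / 4.
    rewrite nrmBC mid_subr mid_subl !nrm_half; lra.
  have E2 : nrm (mid (mid a b) b - mid a b) = nrm (b - a) / 4.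
    rewrite mid_subl mid_subr !nrm_half; lra.
  rewrite E1 in h1; rewrite E2 in h2; rewrite expr0 mulr1 expr2.
  have n0 := nrm_ge0 (b - a).
  have := mulr_ge0 L0 (mulr_ge0 n0 n0).
  have := ler_wpM2l n0 h1; have := ler_wpM2l n0 h2; lra.
have Kc := Km _ _ Ka Kb.
rewrite [msum f k.+2 _ _]/= -/(msum f k.+1 a (mid a b)) -/(msum f k.+1 (mid a b) b).
rewrite [msum f k.+1 a b]/= opprD addrACA.
apply: le_trans (nrmD _ _) _; apply: le_trans (lerD (IH _ _ Ka Kc) (IH _ _ Kc Kb)) _.
by rewrite mid_subl mid_subr nrm_half (exprS 2^-1); move: (2^-1 ^+ k) => h; lra.
Qed.

Definition tri f k a b c := msum f k a b + msum f k b c + msum f k c a.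

(** The medial subdivision of a triangle: the three inner segments are run through
twice, in opposite directions. *)
Lemma tri_split f k a b c : tri f k.+1 a b c =
  tri f k a (mid a b) (mid c a) + tri f k (mid a b) b (mid b c) +
  (tri f k (mid c a) (mid b c) c + tri f k (mid a b) (mid b c) (mid c a)).
Proof.
rewrite /tri /=; move: (mid a b) (mid b c) (mid c a) => m1 m2 m3.
rewrite (msum_sym f k m3 m1) (msum_sym f k m1 m2) (msum_sym f k m2 m3).
move: (msum f k a m1) (msum f k m1 b) (msum f k b m2) (msum f k m2 c)
  (msum f k c m3) (msum f k m3 a) (msum f k m3 m1) (msum f k m1 m2) (msum f k m2 m3).
move=> x1 x2 x3 x4 x5 x6 y1 y2 y3.
rewrite [RHS](AC ((3*3)*(3*3)) (((1*4)*(5*8)*(9*3))*((2*12)*(6*10)*(7*11)))).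
by rewrite /= !addNr !addr0.
Qed.

End Msum.
End Midpoint.

(** * Goursat's theorem and the mean value inequality *)
Section Goursat.
Variable R : realType.
Implicit Types V W : normedModType (Cx R).
Local Notation C := (Cx R).
Variable V : normedModType (Cx R).
Implicit Types (f g : C -> V).

Lemma diff1 f (c z : C) : 'd f c z = z *: 'd f c 1.
Proof. by rewrite -linearZ /= [_ *: _]mulr1. Qed.

(** Affine functions have primitives, and midpoint sums integrate them exactly. *)
Lemma msum_sub_affine f (u v : V) k a b c :
  tri f k a b c = tri (fun z => f z - (u + z *: v)) k a b c.
Proof.
rewrite /tri !msumB !msum_affine.
rewrite [RHS](AC (2*2*2) ((1*3*5)*(2*4*6))) /= -!opprD.
rewrite [X in _ - X](AC (2*2*2) ((1*3*5)*(2*4*6))) /=.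
rewrite -!(scalerDl u) -!(scalerDl v).
have -> : b - a + (c - b) + (a - c) = 0 by ring.
have -> : (b ^+ 2 - a ^+ 2) / 2 + (c ^+ 2 - b ^+ 2) / 2 + (a ^+ 2 - c ^+ 2) / 2 = 0 by field.
by rewrite !scale0r addr0 subr0.
Qed.

(** Goursat's argument. If the sums did not tend to 0, one of the four medial
triangles would carry a quarter of the defect, and so on down to a point z. At z
the function is affine up to an error that is small compared with the diameter,
and the affine part contributes nothing; as there are three sides, the sums over
a triangle of diameter about d 2^-l are o(4^-l), uniformly in k. *)
Lemma goursat f K a b c : mid_closed K -> seq_closed K ->
  (forall z, K z -> differentiable f z) -> K a -> K b -> K c ->
  forall e, 0 < e -> exists N, forall k, (N <= k)%N -> nrm (tri f k a b c) <= e.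
Proof.
move=> Km Kc df Ka Kb Kc' e e0; apply: contrapT => /forallNP nh.
pose d := nrm (b - a) + nrm (c - b) + nrm (a - c).
have d0 : 0 <= d by rewrite !addr_ge0 ?nrm_ge0.
pose Bad l (t : C * C * C) := [/\ [/\ K t.1.1, K t.1.2 & K t.2],
  [/\ nrm (t.1.2 - t.1.1) <= d * 2^-1 ^+ l, nrm (t.2 - t.1.2) <= d * 2^-1 ^+ l &
    nrm (t.1.1 - t.2) <= d * 2^-1 ^+ l] &
  forall N, exists2 k, (N <= k)%N & e * (2^-1 ^+ l) ^+ 2 < nrm (tri f k t.1.1 t.1.2 t.2)].
have B0 : Bad 0%N (a, b, c).
  split=> //=; rewrite ?expr0 ?mulr1.
    have := nrm_ge0 (b - a); have := nrm_ge0 (c - b); have := nrm_ge0 (a - c).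
    by rewrite /d; split; lra.
  move=> N; have /existsNP[k /not_implyP[Nk /negP]] := nh N.
  by rewrite -ltNge => h; exists k => //; rewrite expr1n mulr1.
have Bs l t : Bad l t -> exists2 t', Bad l.+1 t' &
     nrm (t'.1.1 - t.1.1) <= d * 2^-1 ^+ l.
  case: t => -[x y] z [/= [Kx Ky Kz] [h1 h2 h3] hN].
  have Kxy := Km _ _ Kx Ky; have Kyz := Km _ _ Ky Kz; have Kzx := Km _ _ Kz Kx.
  have E : e * (2^-1 ^+ l.+1) ^+ 2 = e * (2^-1 ^+ l) ^+ 2 / 4.
    by rewrite (exprS 2^-1 l); move: (2^-1 ^+ l) => h; lra.
  have S (t' : C * C * C) : (forall N, exists2 k, (N <= k)%N &
      e * (2^-1 ^+ l.+1) ^+ 2 < nrm (tri f k t'.1.1 t'.1.2 t'.2)) \/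
      exists N, forall k, (N <= k)%N ->
      nrm (tri f k t'.1.1 t'.1.2 t'.2) <= e * (2^-1 ^+ l.+1) ^+ 2.
    case: (pselect (exists N, forall k, (N <= k)%N ->
      nrm (tri f k t'.1.1 t'.1.2 t'.2) <= e * (2^-1 ^+ l.+1) ^+ 2)); first by right.
    move=> /forallNP H; left => N.
    have /existsNP[k /not_implyP[Nk /negP]] := H N.
    by rewrite -ltNge => ?; exists k.
  have d2 (u v : C) : nrm (v - u) <= d * 2^-1 ^+ l -> nrm ((v - u) / 2) <= d * 2^-1 ^+ l.+1.
    by rewrite nrm_half exprS; move: (2^-1 ^+ l) => h; lra.
  have d3 (u v : C) : nrm (v - u) <= d * 2^-1 ^+ l -> nrm ((v - u) / 2) <= d * 2^-1 ^+ l.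
    by rewrite nrm_half; have := nrm_ge0 (v - u); move: (2^-1 ^+ l) => h; lra.
  have mm (u v w : C) : mid v w - mid u v = (w - u) / 2 by rewrite /mid; field.
  have mm' (u v w : C) : mid u v - mid v w = (u - w) / 2 by rewrite /mid; field.
  (* If none of the four medial triangles is bad, the big one is not bad either. *)
  have [H1|[N1 H1]] := S (x, mid x y, mid z x).
    exists (x, mid x y, mid z x); rewrite /= ?subrr ?nrm0 ?mulr_ge0 ?expr_half_ge0 //.
    split=> //=; split.
    - by rewrite mid_subl d2.
    - by rewrite mm' d2.
    - by rewrite mid_subr d2.
  have [H2|[N2 H2]] := S (mid x y, y, mid y z).
    exists (mid x y, y, mid y z); rewrite /= ?mid_subl ?d3 //.
    split=> //=; split.
    - by rewrite mid_subr d2.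
    - by rewrite mid_subl d2.
    - by rewrite mm' d2.
  have [H3|[N3 H3]] := S (mid z x, mid y z, z).
    exists (mid z x, mid y z, z); rewrite /= ?mid_subr.
      split=> //=; split.
      - by rewrite mm' d2.
      - by rewrite mid_subr d2.
      - by rewrite mid_subl d2.
    by rewrite midC mid_subl d3 // nrmBC.
  have [H4|[N4 H4]] := S (mid x y, mid y z, mid z x).
    exists (mid x y, mid y z, mid z x); rewrite /= ?mid_subl ?d3 //.
    split=> //=; split.
    - by rewrite mm d2 // nrmBC.
    - by rewrite mm d2 // nrmBC.
    - by rewrite mm d2 // nrmBC.
  have [k] := hN (maxn (maxn N1 N2) (maxn N3 N4)).+1.
  case: k => // k; rewrite ltnS !geq_max => /andP[/andP[k1 k2] /andP[k3 k4]].
  rewrite tri_split ltNge => /negP; case.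
  move: (H1 _ k1) (H2 _ k2) (H3 _ k3) (H4 _ k4); rewrite /= E => {}H1 {}H2 {}H3 {}H4.
  apply: le_trans (nrmD _ _) _; apply: le_trans (lerD (nrmD _ _) (nrmD _ _)) _.
  lra.
have [z [s hs]] := bisection B0 Bs.
have Kz : K z.
  apply: Kc => e' e'0; have [N hN] := expr_half_small (2 * d) e'0.
  exists (s N).1.1; first by have [[[]]] := hs N.
  by apply: le_trans (hs N).2 (hN _ _).
(* The error of the affine approximation is at most eps * 4 d h on a ball of
   radius 4 d h containing the triangle, and the three sides have length at most
   d h: the sum is at most 12 d^2 eps h^2, to be compared with e h^2. *)
pose eps := e / (12 * d ^+ 2 + 1) / 2.
have D0 : 0 < 12 * d ^+ 2 + 1 by rewrite ltr_wpDl // mulr_ge0 // sqr_ge0.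
have eps0 : 0 < eps by rewrite !divr_gt0.
have epsE : eps * (12 * d ^+ 2) < e.
  rewrite /eps mulrAC ltr_pdivrMr // mulrAC ltr_pdivrMr //.
  have : 0 <= d ^+ 2 by rewrite sqr_ge0.
  nra.
have [r r0 hr] := diff_nrm (df _ Kz) eps0.
have [l hl] := expr_half_small (4 * d) (divr_gt0 r0 (ltr0Sn _ 1)).
have [[[_ _ _] [h1 h2 h3] hN] h4] := hs l.
move: (hl _ (leqnn l)) h1 h2 h3 hN h4.
case: (s l) => -[x y] w /=; have := expr_half_ge0 R l.
move: (2^-1 ^+ l) => h h0 hl' h1 h2 h3 hN h4.
have [k _] := hN 0%N; rewrite ltNge => /negP; apply.
rewrite (msum_sub_affine f (f z - z *: 'd f z 1) ('d f z 1)).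
pose B := [set t | nrm (t - z) <= 4 * d * h].
have dh : 0 <= d * h by rewrite mulr_ge0.
have Bx : B x by rewrite /B /=; lra.
have By : B y by rewrite /B /=; have := nrm_tri y x z; lra.
have Bw : B w.
  by rewrite /B /=; have := nrm_tri w x z; rewrite (nrmBC w x); lra.
have Bf t : B t -> nrm (f t - (f z - z *: 'd f z 1 + t *: 'd f z 1)) <= eps * (4 * d * h).
  move=> Bt; have := hr t; rewrite (le_lt_trans Bt) ?(le_lt_trans hl') ?ltr_pdivrMr
      ?ltr_pMr ?ltr1n //.
  move=> /(_ isT) H; apply: le_trans (le_trans H _).
    by rewrite (diff1 f z (t - z)) scalerBl !opprD !opprK !addrA [X in nrm X <= nrm _]addrAC.
  by rewrite ler_wpM2l // ltW.
have P u v : B u -> B v -> nrm (v - u) <= d * h ->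
   nrm (msum (fun t => f t - (f z - z *: 'd f z 1 + t *: 'd f z 1)) k u v) <= eps * (4 * d
       * h) * (d * h).
  move=> Bu Bv huv; apply: le_trans (@msum_bound _ _ (fun t => f t - _) B _ k _ _
      (@mid_closed_ball _ _ _) Bf Bu Bv) _.
  by apply: ler_wpM2l => //; rewrite mulr_ge0 ?(ltW eps0) // -mulrA mulr_ge0.
rewrite /tri; apply: le_trans (nrmD _ _) _; apply: le_trans (lerD (nrmD _ _) (lexx _)) _.
apply: le_trans (lerD (lerD (P _ _ Bx By h1) (P _ _ By Bw h2)) (P _ _ Bw Bx h3)) _.
have := ler_wpM2r (sqr_ge0 h) (ltW epsE); lra.
Qed.

End Goursat.

Section Cauchy.
Variable R : realType.
Local Notation C := (Cx R).

(** Bisection again: a segment on which g stretches by more than M + e contains a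
half with the same property, which contradicts the value of g' at the limit. *)
Lemma mvt (V : normedModType C) (g : C -> V) K M a b : mid_closed K -> seq_closed K ->
  (forall z, K z -> differentiable g z /\ nrm ('d g z 1) <= M) -> K a -> K b ->
  nrm (g b - g a) <= M * nrm (b - a).
Proof.
move=> Km Kc dg Ka Kb; apply: (@le_eps _ _ _ (nrm (b - a))) => e e0.
rewrite leNgt; apply/negP => H.
pose n := nrm (b - a); have n0 : 0 <= n := nrm_ge0 _.
pose Bad l (t : C * C) := [/\ K t.1, K t.2, nrm (t.2 - t.1) = n * 2^-1 ^+ l &
  (M + e) * nrm (t.2 - t.1) < nrm (g t.2 - g t.1)].
have B0 : Bad 0%N (a, b).
  by split => //=; rewrite ?expr0 ?mulr1 // mulrDl [e * _]mulrC.
have Bs l t : Bad l t -> exists2 t', Bad l.+1 t' & nrm (t'.1 - t.1) <= n * 2^-1 ^+ l.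
  case: t => x y [/= Kx Ky h1 h2]; have Kxy := Km _ _ Kx Ky.
  have E1 : nrm (mid x y - x) = n * 2^-1 ^+ l.+1 by rewrite mid_subl nrm_half h1 exprS; lra.
  have E2 : nrm (y - mid x y) = n * 2^-1 ^+ l.+1 by rewrite mid_subr nrm_half h1 exprS; lra.
  have [h3|h3] := ltP ((M + e) * nrm (mid x y - x)) (nrm (g (mid x y) - g x)).
    by exists (x, mid x y) => //=; rewrite subrr nrm0 mulr_ge0 // expr_half_ge0.
  have [h4|h4] := ltP ((M + e) * nrm (y - mid x y)) (nrm (g y - g (mid x y))).
    exists (mid x y, y) => //=; rewrite E1 exprS.
    by have := mulr_ge0 n0 (expr_half_ge0 R l); lra.
  have := nrm_tri (g y) (g (mid x y)) (g x).
  by rewrite E1 E2 h1 exprS in h2 h3 h4 *; lra.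
have [z [s hs]] := bisection B0 Bs.
have Kz : K z.
  apply: Kc => e' e'0; have [N hN] := expr_half_small (2 * n) e'0.
  exists (s N).1; first by have [[]] := hs N.
  by apply: le_trans (hs N).2 (hN _ _).
have [dz Mz] := dg _ Kz.
have eps0 : 0 < e / 5 by rewrite divr_gt0.
have [r r0 hr] := diff_nrm dz eps0.
have [l hl] := expr_half_small (4 * n) r0.
have [[_ _ h1 h2] h3] := hs l.
move: (hl _ (leqnn l)) h1 h2 h3; case: (s l) => x y /=.
have := expr_half_gt0 R l.
move: (2^-1 ^+ l) => h h0 hl' h1 h2 h3.
have [n00|n1] := eqVneq n 0.
  by move: H; have := nrm_eq0 n00 => /subr0_eq ->; rewrite !subrr !nrm0 mulr0 mul0r addr0 ltxx.
have np : 0 < n * h by rewrite mulr_gt0 // lt_neqAle eq_sym n1.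
have hx : nrm (x - z) < r by lra.
have hy3 : nrm (y - z) <= 3 * (n * h) by have := nrm_tri y x z; lra.
have hy : nrm (y - z) < r by lra.
have D : nrm ('d g z (y - x)) <= M * nrm (y - x).
  by rewrite diff1 nrmZ mulrC ler_wpM2r ?nrm_ge0.
have E : g y - g x = (g y - g z - 'd g z (y - z)) + 'd g z (y - x) - (g x - g z - 'd g z (x - z)).
  have -> : 'd g z (y - x) = 'd g z (y - z) - 'd g z (x - z).
    by rewrite -linearB; congr ('d g z _); ring.
  by rewrite subrKA opprB addrA subrK opprB addrA subrK.
have := nrmB (g y - g z - 'd g z (y - z) + 'd g z (y - x)) (g x - g z - 'd g z (x - z)).
have := nrmD (g y - g z - 'd g z (y - z)) ('d g z (y - x)).
rewrite -E; have := hr _ hx; have := hr _ hy.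
rewrite h1 in h2 D *; nra.
Qed.

End Cauchy.

(** * The Cauchy estimate *)
Section CauchyEst.
Variable R : realType.
Local Notation C := (Cx R).

Section Scale.
Variables (E V : normedModType C).

Lemma scale_bilinear : bilinear_for
    (GRing.Scale.Law.clone _ _ *:%R _) (GRing.Scale.Law.clone _ _ *:%R _)
    (@GRing.scale C V).
Proof.
split=> [u'|u] a x y /=.
- by rewrite scalerDl scalerA.
- by rewrite scalerDr !scalerA mulrC.
Qed.

HB.instance Definition _ := bilinear_isBilinear.Build C C V V _ _ (@GRing.scale C V)
  scale_bilinear.

Lemma differentiable_scale (k : E -> C) (f : E -> V) x :
  differentiable k x -> differentiable f x -> differentiable (fun y => k y *: f y) x.
Proof.
move=> dk df.
have := @differentiable_bilin _ _ _ _ (@GRing.scale C V) (k x, f x).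
move=> /(_ (@scale_continuous _ _)) d.
by apply: (differentiable_comp (differentiable_pair dk df) d).
Qed.
End Scale.

Variable V : normedModType C.
Implicit Types g : C -> V.

Definition ii : C := ('i%C : R[i]).

Lemma ii2 : ii * ii = -1.
Proof. by rewrite -expr2; exact: complex.sqr_i. Qed.

Lemma nrm_ii : nrm ii = 1.
Proof.
by apply: toC_inj; rewrite -nrmE normc_def /= expr0n expr1n add0r sqrtr1.
Qed.

(** The average (up to a factor 4) of g(t) / t^2 dt over the quarter turns. It
turns the integral over the boundary of a square into the integral over one
side, which lies in a half plane avoiding the pole. *)
Definition rotsum g (t : C) : V := (t^-1 * t^-1) *:
  (g t - ii *: g (ii * t) - g (- t) + ii *: g (- (ii * t))).

Lemma ii_neq0 : ii != 0.
Proof.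
apply/eqP => h; have := nrm_ii; rewrite h nrm0 => /eqP.
by rewrite eq_sym oner_eq0.
Qed.

Lemma rotsum_rot g t : ii *: rotsum g (ii * t) = rotsum g t.
Proof.
rewrite /rotsum mulrA ii2 mulN1r opprK invfM scalerA.
have -> : ii^-1 = - ii.
  by apply: (mulfI ii_neq0); rewrite mulrN ii2 opprK mulfV // ii_neq0.
have -> : ii * (- ii / t * (- ii / t)) = (t^-1 * t^-1) * - ii.
  transitivity ((ii * ii) * ii * (t^-1 * t^-1)); first by ring.
  by rewrite ii2; ring.
rewrite -[LHS]scalerA; congr (_ *: _).
move: (g t) (g (ii * t)) (g (- t)) (g (- (ii * t))) => A B D F.
rewrite !scalerDr !scalerN !scaleNr !opprK !scalerA ii2 !scaleN1r opprK.
by rewrite [LHS](AC (1*1*1*1) (4*1*2*3)).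
Qed.

Lemma msum_rot (f : C -> V) k a b : (forall t, ii *: f (ii * t) = f t) ->
  msum f k (ii * a) (ii * b) = msum f k a b.
Proof.
move=> hf.
have hm x y : mid (ii * x) (ii * y) = ii * mid x y by rewrite /mid; ring.
elim: k a b => [|k IH] a b /=; last by rewrite hm !IH.
by rewrite hm -mulrBr mulrC -scalerA hf.
Qed.

(** The points r (1 + i y), for |y| <= 1, form one side of the square of half-side
r centred at 0. *)
Definition vline (r y : R) : C := toC r * (1 + ii * toC y).

Lemma mid_vline r x y : mid (vline r x) (vline r y) = vline r ((x + y) / 2).
Proof. by rewrite /mid /vline !(toCM, toCD, toCV, toC_nat); field. Qed.

(** A lower bound for the integral of dt / t over a piece of a side: with
t = r (1 + i y) it is i (1 - i y) / (1 + y^2) dy, and 1 + y^2 <= 2. *)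
Lemma Im_msum_inv r k x y : 0 < r -> -1 <= x -> x <= y -> y <= 1 ->
  (y - x) / 2 <= complex.Im (msum (fun t : C => t^-1 : C) k (vline r x) (vline r y) : R[i]).
Proof.
move=> r0; elim: k x y => [|k IH] x y x1 xy y1; last first.
  rewrite /= mid_vline (raddfD (@complex.Im R)).
  have := IH x ((x + y) / 2) x1; have := IH ((x + y) / 2) y.
  move=> /(_ _ _ y1) h1 /(_ _ _) h2.
  have {}h1 := h1 ltac:(lra) ltac:(lra).
  have {}h2 := h2 ltac:(lra) ltac:(lra).
  lra.
rewrite [msum _ _ _ _](_ : _ = (vline r y - vline r x) / mid (vline r x) (vline r y)) //.
rewrite mid_vline; set z := (x + y) / 2.
have z2 : 0 < 1 + z ^+ 2 by rewrite ltr_wpDr // sqr_ge0.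
have -> : (vline r y - vline r x) / vline r z =
   (((y - x) * z / (1 + z ^+ 2)) +i* ((y - x) / (1 + z ^+ 2)))%C :> C.
  clearbody z; have r0' : toC r != 0 by rewrite toC_eq0 gt_eqF.
  have z0' : toC (1 + z ^+ 2) != 0 by rewrite toC_eq0 gt_eqF.
  have z1 : 1 + ii * toC z != 0.
    apply: contra_neq z0' => h; rewrite toCD expr2 toCM.
    transitivity ((1 + ii * toC z) * (1 - ii * toC z)); last by rewrite h mul0r.
    transitivity (1 - (ii * ii) * (toC z * toC z)); last by ring.
    by rewrite ii2; ring.
  have -> : (((y - x) * z / (1 + z ^+ 2)) +i* ((y - x) / (1 + z ^+ 2)))%C =
    (toC (y - x) * (toC z + ii)) / toC (1 + z ^+ 2) :> C.
    rewrite -toCV /toC /ii; simpc; congr (_ +i* _)%C; ring.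
  apply/eqP; rewrite /vline eqr_div ?mulf_neq0 //; apply/eqP.
  rewrite !(toCD, toCN, expr2, toCM) toC1.
  move: (toC z) (toC r) (toC x) (toC y) => z' r' x' y'.
  transitivity (r' * ((y' - x') * (ii + ii * (z' * z')))); first by ring.
  transitivity (r' * ((y' - x') * (z' + ii * z' * z' + ii + (ii * ii) * z'))); last by ring.
  rewrite ii2; ring.
rewrite /=; apply: ler_wpM2l; first lra.
rewrite lef_pV2 ?posrE //.
have : -1 <= z by rewrite /z; lra.
have : z <= 1 by rewrite /z; lra.
nra.
Qed.

(** For 0 < r, a convex set avoiding 0; it contains sides of squares ([vline_halfdisc]). *)
Definition halfdisc (r s : R) : set C :=
  [set t : C | r <= complex.Re (t : R[i]) /\ nrm t <= s].

Lemma halfdisc_mid r s : mid_closed (halfdisc r s).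
Proof.
move=> a b [a1 a2] [b1 b2]; split.
  have -> : mid a b = toC (2^-1) * (a + b) by rewrite /mid toCV toC_nat mulrC.
  have -> : complex.Re (toC 2^-1 * (a + b) : R[i]) = 2^-1 * (complex.Re (a : R[i]) +
      complex.Re (b : R[i])).
    by case: a {a1 a2} => a a'; case: b {b1 b2} => b b' /=; rewrite mul0r subr0.
  lra.
have := mid_closed_ball (c := 0) (r := s) (a := a) (b := b).
by rewrite /= !subr0; apply.
Qed.

Lemma halfdisc_closed r s : seq_closed (halfdisc r s).
Proof.
move=> c h; split.
  rewrite -subr_le0; apply: le0_eps => e /h[z [h1 _] h2].
  have := nrm_Re (z - c); rewrite (raddfB (@complex.Re R)) => h3.
  have := ler_norm (complex.Re (z : R[i]) - complex.Re (c : R[i])); lra.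
apply: (@le_eps _ _ _ 1) => e /h[z [_ h1]] h2.
have := nrm_trir c z; rewrite nrmBC; lra.
Qed.

Lemma vline_halfdisc r y r' s : `|y| <= 1 -> 0 < r -> r' <= r -> 2 * r <= s ->
  halfdisc r' s (vline r y).
Proof.
move=> y1 r0 r1 r2; split.
  by rewrite /vline /ii /toC /=; simpc.
rewrite /vline nrmM nrm_toC gtr0_norm //.
apply: le_trans r2; rewrite mulrC ler_pM2r //.
apply: le_trans (nrmD _ _) _; rewrite nrm1 nrmM nrm_ii nrm_toC; lra.
Qed.

(** Goursat's theorem in the trapezoid between the right sides of two concentric
squares of half-sides r1 < r2, applied to [rotsum] g: the oblique sides are
exchanged by a quarter turn and cancel, so the sums over the two vertical sides
agree in the limit. On the outer side the sum is bounded by a multiple of M / rho.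
On the inner side, for small r1, [rotsum] g is close to 4 g'(0) / t, because the
constant term of g is killed by the rotations, and the sum of 1 / t is at least 1
in modulus. *)
Lemma cauchy_estimate0 g rho M : 0 < rho ->
  (forall t, nrm t < rho -> differentiable g t /\ nrm (g t) <= M) ->
  nrm ('d g 0 1) <= 6 * M / rho.
Proof.
move=> rho0 hg.
have drotsum t : t != 0 -> nrm t < rho -> differentiable (rotsum g) t.
  move=> t0 ht.
  have dinv : differentiable (fun t : C => t^-1) t by exact: differentiable_Rinv.
  have di : differentiable (fun t : C => ii * t) t.
    by apply: (@differentiableM _ _ (cst ii) id).
  have dm (k : C -> C) : differentiable k t -> nrm (k t) < rho -> differentiable (fun t =>
      g (k t)) t.
    by move=> dk /hg[h _]; exact: (differentiable_comp dk h).
  apply: differentiable_scale; first exact: (differentiableM dinv dinv).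
  apply: differentiableD; last first.
    apply: (@differentiableZ _ _ _ (fun t => g (- (ii * t)))).
    apply: (dm (fun t => - (ii * t))); first exact: differentiableN.
    by rewrite nrmN nrmM nrm_ii mul1r.
  apply: differentiableB; last first.
    by apply: (dm (fun t => - t)); [exact: differentiableN | rewrite nrmN].
  apply: differentiableB; first exact: (hg _ ht).1.
  apply: (@differentiableZ _ _ _ (fun t => g (ii * t))).
  by apply: (dm (fun t => ii * t)); rewrite // nrmM nrm_ii mul1r.
have vline1 r : vline r 1 = ii * vline r (-1).
  rewrite /vline toCN toC1; transitivity (toC r * (ii + - (ii * ii))); last by ring.
  by rewrite ii2; ring.
set r2 := rho / 3.
have r20 : 0 < r2 by rewrite divr_gt0.
have norm1 : `|1 : R| <= 1 by rewrite normr1.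
have normN1 : `|- 1 : R| <= 1 by rewrite normrN1.
have nrm_side r : 0 < r -> nrm (vline r 1 - vline r (-1)) = 2 * r.
  move=> r0; have -> : vline r 1 - vline r (-1) = 2%:R * (ii * toC r).
    by rewrite /vline toCN toC1; ring.
  by rewrite !nrmM nrm_nat nrm_ii nrm_toC gtr0_norm // mul1r.
have neq0 r t : 0 < r -> r <= complex.Re (t : R[i]) -> t != 0.
  by move=> r0 h; apply: contraTneq h => ->; rewrite -ltNge.
have nge (t : C) : complex.Re (t : R[i]) <= nrm t.
  by apply: le_trans (ler_norm _) (nrm_Re _).
(* Outer side: four values of g, bounded by M, over r2^2, times the length 2 r2. *)
have outer k : nrm (msum (rotsum g) k (vline r2 (-1)) (vline r2 1)) <= 24 * M / rho.
  apply: le_trans (msum_bound (K := halfdisc r2 (2 * r2)) (M := 4 * M / r2 ^+ 2) k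
      (@halfdisc_mid _ _) _ _ _) _.
  - move=> t [t1 t2]; rewrite /rotsum nrmZ nrmM nrmV.
    have t3 : r2 <= nrm t := le_trans t1 (nge t).
    have t4 : nrm t < rho by rewrite (le_lt_trans t2) // /r2; lra.
    have t5 : nrm (- t) < rho by rewrite nrmN.
    have t6 : nrm (ii * t) < rho by rewrite nrmM nrm_ii mul1r.
    have t7 : nrm (- (ii * t)) < rho by rewrite nrmN.
    have M0 : 0 <= M by apply: le_trans (nrm_ge0 _) (hg _ t4).2.
    rewrite mulrC ler_pM ?nrm_ge0 ?mulr_ge0 ?invr_ge0 ?nrm_ge0 //.
      apply: le_trans (nrmD _ _) _; apply: le_trans (lerD (nrmB _ _) (lexx _)) _.
      apply: le_trans (lerD (lerD (nrmB _ _) (lexx _)) (lexx _)) _.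
      rewrite !nrmZ nrm_ii !mul1r.
      have := (hg _ t4).2; have := (hg _ t5).2; have := (hg _ t6).2; have := (hg _ t7).2; lra.
    have t8 := lt_le_trans r20 t3.
    by rewrite expr2 invfM ler_pM ?invr_ge0 ?nrm_ge0 // lef_pV2 ?posrE.
  - by apply: vline_halfdisc.
  - by apply: vline_halfdisc.
  - rewrite nrm_side // /r2 le_eqVlt; apply/orP; left; apply/eqP.
    by field; rewrite gt_eqF.
pose v := 'd g 0 1.
have g0 : nrm (0 : C) < rho by rewrite nrm0.
apply: (@le_eps _ _ _ 3) => e e0.
have [d d0 hd] := diff_nrm (hg _ g0).1 e0.
set r1 := Num.min (d / 3) r2 / 2.
have m0 : 0 < Num.min (d / 3) r2 by rewrite lt_min divr_gt0.
have r10 : 0 < r1 by rewrite divr_gt0.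
have r1d : 2 * r1 < d.
  have : Num.min (d / 3) r2 <= d / 3 by rewrite ge_min lexx.
  by rewrite /r1; lra.
have r12 : r1 < r2.
  have : Num.min (d / 3) r2 <= r2 by rewrite ge_min lexx orbT.
  by rewrite /r1; lra.
set a1 := vline r1 (-1); set b1 := vline r1 1; set a2 := vline r2 (-1); set b2 := vline r2 1.
set K := halfdisc r1 (2 * r2).
have Ka1 : K a1 by apply: vline_halfdisc => //; lra.
have Kb1 : K b1 by apply: vline_halfdisc => //; lra.
have Ka2 : K a2 by apply: vline_halfdisc => //; lra.
have Kb2 : K b2 by apply: vline_halfdisc => //; lra.
have dK z : K z -> differentiable (rotsum g) z.
  move=> [z1 z2]; apply: drotsum; first exact: neq0 z1.
  by rewrite (le_lt_trans z2) // /r2; lra.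
have [N1 h1] := goursat (@halfdisc_mid _ _) (@halfdisc_closed _ _) dK Ka1 Ka2 Kb2 e0.
have [N2 h2] := goursat (@halfdisc_mid _ _) (@halfdisc_closed _ _) dK Ka1 Kb2 Kb1 e0.
set k := maxn N1 N2.
have {}h1 := h1 k (leq_maxl _ _); have {}h2 := h2 k (leq_maxr _ _).
(* Two triangles make up the trapezoid a1 a2 b2 b1; its oblique sides cancel. *)
have trap : tri (rotsum g) k a1 a2 b2 + tri (rotsum g) k a1 b2 b1 =
    msum (rotsum g) k a2 b2 - msum (rotsum g) k a1 b1.
  have S : msum (rotsum g) k b2 b1 = - msum (rotsum g) k a1 a2.
    by rewrite msum_sym /b1 /b2 !vline1 msum_rot //; exact: rotsum_rot.
  rewrite /tri S (msum_sym _ _ a1 b2) (msum_sym _ _ a1 b1).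
  move: (msum (rotsum g) k a1 a2) (msum (rotsum g) k a2 b2) (msum (rotsum g) k a1 b2) (msum
      (rotsum g) k a1 b1).
  move=> x1 x2 x3 x4; rewrite [LHS](AC (3*3) (((1*5)*(3*4))*(2*6))) /=.
  by rewrite subrr addNr !add0r.
pose w : V := 4%:R *: v.
pose E (t : C) : V := rotsum g t - t^-1 *: w.
have cw : msum (fun t : C => t^-1 *: w) k a1 b1 = (msum (fun t : C => t^-1 : C) k a1 b1) *: w.
  elim: (k) (a1) (b1) => [|k' IH] a b /=; first by rewrite scalerA.
  by rewrite !IH scalerDl.
have c1 : 1 <= nrm (msum (fun t : C => t^-1 : C) k a1 b1).
  apply: le_trans (nrm_Im _); apply: le_trans (ler_norm _).
  by apply: le_trans (Im_msum_inv k r10 (lexx _) _ (lexx _)); lra.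
(* E is a combination of the remainders of the first-order expansion of g at the
   four points i^k t. *)
have Eb (t : C) : halfdisc r1 (2 * r1) t -> nrm (E t) <= 4 * e / r1.
  move=> [t1 t2]; have t0 : t != 0 := neq0 _ _ r10 t1.
  have q (c : C) : nrm c = 1 -> nrm (g (c * t) - g 0 - (c * t) *: v) <= e * nrm t.
    move=> nc; have := hd (c * t); rewrite subr0 nrmM nc mul1r.
    by rewrite (le_lt_trans t2) // diff1; apply.
  have q1 := q _ (nrm1 R); have q2 := q _ nrm_ii.
  have q3 := q (-1); rewrite nrmN nrm1 in q3; have {}q3 := q3 erefl.
  have q4 := q (- ii); rewrite nrmN nrm_ii in q4; have {}q4 := q4 erefl.
  rewrite mul1r in q1; rewrite mulN1r in q3; rewrite mulNr in q4.
  have -> : E t = (t^-1 * t^-1) *: ((g t - g 0 - t *: v) - ii *: (g (ii * t) - g 0 - (ii * t) *: v)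
      - (g (- t) - g 0 - (- t) *: v) + ii *: (g (- (ii * t)) - g 0 - (- (ii * t)) *: v)).
    rewrite /E /rotsum; have -> : t^-1 *: w = (t^-1 * t^-1) *: ((4%:R * t) *: v).
      by rewrite /w !scalerA; congr (_ *: _); field.
    rewrite -scalerBr; congr (_ *: _).
    move: (g t) (g (ii * t)) (g (- t)) (g (- (ii * t))) (g 0) => A B D F G.
    have e2 : ii *: (B - G - (ii * t) *: v) = ii *: B - ii *: G + t *: v.
      by rewrite !scalerBr scalerA mulrA ii2 mulN1r scaleNr opprK.
    have e4 : ii *: (F - G - (- (ii * t)) *: v) = ii *: F - ii *: G - t *: v.
      by rewrite !scalerBr scalerA mulrN mulrA ii2 mulN1r opprK.
    rewrite e2 e4 (scaleNr t) opprK.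
    have -> : (4%:R * t) *: v = t *: v + t *: v + t *: v + t *: v.
      by rewrite -!scalerDl; congr (_ *: _); ring.
    move: (t *: v) (ii *: B) (ii *: F) (ii *: G) => T B' F' G'.
    rewrite !opprD !opprK !addrA.
    rewrite [RHS](ACl ((((1*4*7)*10*3*6)*9*12*(2*8)*(5*11)))) /=.
    by rewrite addNr subrr !addr0.
  rewrite nrmZ nrmM nrmV.
  have t3 : r1 <= nrm t := le_trans t1 (nge t).
  have t4 := lt_le_trans r10 t3.
  apply: (@le_trans _ _ ((nrm t)^-1 * (nrm t)^-1 * (4 * (e * nrm t)))).
    rewrite ler_wpM2l ?mulr_ge0 ?invr_ge0 ?nrm_ge0 //.
    apply: le_trans (nrmD _ _) _; apply: le_trans (lerD (nrmB _ _) (lexx _)) _.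
    apply: le_trans (lerD (lerD (nrmB _ _) (lexx _)) (lexx _)) _.
    by rewrite !(nrmZ ii) nrm_ii !mul1r; lra.
  rewrite [leLHS](_ : _ = 4 * e / nrm t); last by field; rewrite gt_eqF.
  by rewrite ler_wpM2l ?lef_pV2 ?posrE // mulr_ge0 // ltW.
have SE : nrm (msum E k a1 b1) <= 8 * e.
  apply: le_trans (msum_bound k (@halfdisc_mid _ _) Eb _ _) _; try exact: vline_halfdisc.
  by rewrite nrm_side // le_eqVlt; apply/orP; left; apply/eqP; field; rewrite gt_eqF.
have Ew : nrm w <= 24 * M / rho + 10 * e.
  have ww : nrm w <= nrm (msum (fun t : C => t^-1 *: w) k a1 b1).
    by rewrite cw nrmZ ler_peMl // nrm_ge0.
  have wE : msum (rotsum g) k a1 b1 - msum (fun t : C => t^-1 *: w) k a1 b1 = msum E k a1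
      b1 by rewrite -msumB.
  have := nrm_trir (msum (fun t : C => t^-1 *: w) k a1 b1) (msum (rotsum g) k a1 b1).
  rewrite nrmBC wE.
  have := nrm_trir (msum (rotsum g) k a1 b1) (msum (rotsum g) k a2 b2).
  rewrite nrmBC -trap.
  have := nrmD (tri (rotsum g) k a1 a2 b2) (tri (rotsum g) k a1 b2 b1).
  have := outer k; rewrite -/a2 -/b2; lra.
move: Ew; rewrite /w nrmZ nrm_nat -/v; lra.
Qed.
End CauchyEst.

(** * Holomorphic maps in several variables *)
Section SeveralVariables.
Variable R : realType.
Local Notation C := (Cx R).

Section Tends.
Variable V : normedModType C.

Lemma tends_le (u : nat -> V) l a M N : tends u l ->
  (forall k, (N <= k)%N -> nrm (u k - a) <= M) -> nrm (l - a) <= M.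
Proof.
move=> ul h; apply: (@le_eps _ _ _ 1) => e /ul[N' h'].
have := nrm_tri l (u (maxn N N')) a.
have := h _ (leq_maxl N N'); have := h' _ (leq_maxr N N'); rewrite nrmBC; lra.
Qed.

Lemma tends_uniq (u : nat -> V) l l' : tends u l -> tends u l' -> l = l'.
Proof.
move=> ul ul'; apply: subr0_eq; apply: nrm_eq0; apply/eqP.
rewrite eq_le nrm_ge0 andbT; apply: le0_eps => e /ul'[N h].
exact: tends_le ul h.
Qed.

Lemma tendsD (u v : nat -> V) l m : tends u l -> tends v m ->
  tends (fun k => u k + v k) (l + m).
Proof.
move=> ul vm e e0; have e2 : 0 < e / 2 by rewrite divr_gt0.
have [N h] := ul _ e2; have [N' h'] := vm _ e2.
exists (maxn N N') => k; rewrite geq_max => /andP[/h h1 /h' h2].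
rewrite opprD addrACA; apply: le_trans (nrmD _ _) _; lra.
Qed.

Lemma tendsZ (a : C) (u : nat -> V) l : tends u l -> tends (fun k => a *: u k) (a *: l).
Proof.
move=> ul e e0; have a0 : 0 < nrm a + 1 by rewrite ltr_wpDl // nrm_ge0.
have [N h] := ul _ (divr_gt0 e0 a0); exists N => k /h.
rewrite -scalerBr nrmZ ler_pdivlMr //.
have := nrm_ge0 (u k - l); lra.
Qed.

End Tends.

Variables E V : normedModType C.
Implicit Types f : E -> V.

Lemma diff_line f x h t : differentiable f (x + t *: h) ->
  differentiable (fun s : C => f (x + s *: h)) t /\
  'd (fun s : C => f (x + s *: h)) t 1 = 'd f (x + t *: h) h.
Proof.
move=> df.
have cl : continuous (fun s : C => s *: h) by exact: scalel_continuous.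
have ll : linear (fun s : C => s *: h) by move=> a b c; rewrite scalerDl scalerA.
pose lM := GRing.isLinear.Build _ _ _ _ _ ll.
pose L : {linear C -> E} := HB.pack (fun s : C => s *: h) lM.
have [d1 d2] : differentiable (fun s : C => x + s *: h) t /\
    'd (fun s : C => x + s *: h) t = L :> (C -> E).
  apply: nrm_diff; first exact: cl.
  move=> e e0; exists 1 => // y _; rewrite /L /= scalerBl opprD addrACA subrr add0r subrr nrm0.
  by rewrite mulr_ge0 ?nrm_ge0 // ltW.
split; first exact: (differentiable_comp d1 df).
have := @diff_comp _ _ _ _ (fun s : C => x + s *: h) f t d1 df.
by rewrite /comp => ->; rewrite /= d2 /L /= scale1r.
Qed.

(** Restriction to the complex line through x in the direction h. *)
Lemma cauchy_estimate f x rho M h : 0 < rho ->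
  (forall y, nrm (y - x) < rho -> differentiable f y /\ nrm (f y) <= M) ->
  nrm ('d f x h) <= 6 * M / rho * nrm h.
Proof.
move=> r0 hf; have [->|h0] := eqVneq h 0; first by rewrite linear0 !nrm0 mulr0.
have n0 := nrm_gt0 h0.
have H (t : C) : nrm t < rho / nrm h -> differentiable f (x + t *: h) /\ nrm (f (x + t *: h)) <= M.
  by move=> ht; apply: hf; rewrite addrC addKr nrmZ -ltr_pdivlMr.
have H0 := H 0; rewrite nrm0 divr_gt0 // in H0; have [_ d1] := diff_line (H0 isT).1.
rewrite scale0r addr0 in d1; rewrite -d1.
apply: le_trans (@cauchy_estimate0 _ _ (fun s : C => f (x + s *: h)) _ M (divr_gt0 r0 n0) _) _.
  by move=> t /H[h1 h2]; split; [exact: (diff_line h1).1|].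
by rewrite invf_div mulrA mulrAC.
Qed.

Definition unit_segment : set C :=
  [set t : C | [/\ complex.Im (t : R[i]) = 0, 0 <= complex.Re (t : R[i]) & complex.Re (t :
      R[i]) <= 1]].

Lemma Re_mid (a b : C) : complex.Re (mid a b : R[i]) =
  2^-1 * (complex.Re (a : R[i]) + complex.Re (b : R[i])).
Proof.
have -> : mid a b = toC (2^-1) * (a + b) by rewrite /mid toCV toC_nat mulrC.
by case: a => a a'; case: b => b b' /=; rewrite mul0r subr0.
Qed.

Lemma Im_mid (a b : C) : complex.Im (mid a b : R[i]) =
  2^-1 * (complex.Im (a : R[i]) + complex.Im (b : R[i])).
Proof.
have -> : mid a b = toC (2^-1) * (a + b) by rewrite /mid toCV toC_nat mulrC.
by case: a => a a'; case: b => b b' /=; rewrite mul0r addr0.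
Qed.

Lemma unit_segment_mid : mid_closed unit_segment.
Proof.
move=> a b [a1 a2 a3] [b1 b2 b3]; split; rewrite ?Im_mid ?Re_mid ?a1 ?b1; lra.
Qed.

Lemma unit_segment_closed : seq_closed unit_segment.
Proof.
move=> c h.
have H (e : R) : 0 < e -> exists z : C, [/\ unit_segment z,
   `|complex.Re (z : R[i]) - complex.Re (c : R[i])| <= e &
   `|complex.Im (z : R[i]) - complex.Im (c : R[i])| <= e].
  move=> /h[z z1 z2]; exists z; split=> //.
    by have := nrm_Re (z - c); rewrite (raddfB (@complex.Re R)) => /le_trans; apply.
  by have := nrm_Im (z - c); rewrite (raddfB (@complex.Im R)) => /le_trans; apply.
split.
- apply/eqP; rewrite -normr_le0; apply: le0_eps => e /H[z [[z1 _ _] _]].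
  by rewrite z1 sub0r normrN.
- rewrite -oppr_le0; apply: le0_eps => e /H[z [[_ z1 _] + _]].
  by rewrite ler_norml => /andP[]; lra.
- rewrite -subr_le0; apply: le0_eps => e /H[z [[_ _ z1] + _]].
  by rewrite ler_norml => /andP[]; lra.
Qed.

Lemma mvt_line f x h M :
  (forall t, unit_segment t -> differentiable f (x + t *: h) /\ nrm ('d f (x + t *: h) h) <= M) ->
  nrm (f (x + h) - f x) <= M.
Proof.
move=> H; have := @mvt _ _ (fun s : C => f (x + s *: h)) unit_segment M 0 1
    unit_segment_mid unit_segment_closed.
rewrite scale1r scale0r addr0 subr0 nrm1 mulr1; apply.
- by move=> z /H[h1 h2]; have [? ->] := diff_line h1.
- by split => //=; rewrite ler01.
- by split => //=; rewrite ler01.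
Qed.

Lemma nrm_segment t : unit_segment t -> nrm t <= 1.
Proof.
move=> [t1 t2 t3]; apply: le_trans (nrm_ReIm _) _.
by rewrite t1 normr0 addr0 ger0_norm.
Qed.

Lemma unit_segmentP t : unit_segment t -> exists2 s : R, 0 <= s <= 1 & t = toC s.
Proof.
move=> [t1 t2 t3]; exists (complex.Re (t : R[i])); first by rewrite t2.
by case: t t1 {t2 t3} => a b /= ->.
Qed.

Lemma ball_segment (x y z : E) r t : nrm (y - x) < r -> nrm (z - x) < r ->
  unit_segment t -> nrm (z + t *: (y - z) - x) < r.
Proof.
move=> hy hz /unit_segmentP[s /andP[s0 s1] ->].
have -> : z + toC s *: (y - z) - x = toC s *: (y - x) + (1 - toC s) *: (z - x).
  rewrite scalerBl scale1r addrCA -scalerBr opprB addrA subrK addrAC //.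
apply: le_lt_trans (nrmD _ _) _; rewrite !nrmZ -toC1 -toCN -toCD !nrm_toC.
rewrite !ger0_norm ?subr_ge0 //.
have [->|sn0] := eqVneq s 0; first by rewrite mul0r add0r subr0 mul1r.
have sp : 0 < s by rewrite lt_neqAle eq_sym sn0.
have := ltr_pM2l sp (nrm (y - x)) r; rewrite hy => /idP h1.
have : (1 - s) * nrm (z - x) <= (1 - s) * r by rewrite ler_wpM2l ?subr_ge0 // ltW.
lra.
Qed.

(** The Cauchy estimate bounds the derivative along the segment from z to y. *)
Lemma cauchy_lipschitz f x rho M y z : 0 < rho ->
  (forall y, nrm (y - x) < rho -> differentiable f y /\ nrm (f y) <= M) ->
  nrm (y - x) < rho / 2 -> nrm (z - x) < rho / 2 ->
  nrm (f y - f z) <= 12 * M / rho * nrm (y - z).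
Proof.
move=> r0 hf hy hz; have := @mvt_line f z (y - z) (12 * M / rho * nrm (y - z)).
rewrite [z + _]addrC subrK; apply => t ht.
have ht' := ball_segment hy hz ht.
have B w : nrm (w - (z + t *: (y - z))) < rho / 2 -> nrm (w - x) < rho.
  by move=> hw; have := nrm_tri w (z + t *: (y - z)) x; lra.
split; first by apply: (hf _ _).1; lra.
apply: le_trans (@cauchy_estimate f _ (rho / 2) M _ _ _) _; first by rewrite divr_gt0.
  by move=> w /B /hf.
by rewrite ler_wpM2r ?nrm_ge0 // invf_div mulrA; lra.
Qed.

Lemma diff_shift f (x c : E) : differentiable f (x + c) ->
  differentiable (fun y => f (y + c)) x /\ 'd (fun y => f (y + c)) x = 'd f (x + c) :> (E -> V).
Proof.
move=> df; apply: nrm_diff; first exact: diff_continuous.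
move=> e /(diff_nrm df)[d d0 hd]; exists d => // y hy.
by have := hd (y + c); rewrite opprD addrACA subrr addr0; apply.
Qed.

Lemma diff_sub f g (x : E) : differentiable f x -> differentiable g x ->
  differentiable (fun y => f y - g y) x /\
  forall h, 'd (fun y => f y - g y) x h = 'd f x h - 'd g x h.
Proof.
move=> df dg; split; first exact: differentiableB.
by move=> h; exact: (congr1 (@^~ h) (diffB df dg)).
Qed.

(** The Cauchy estimate applied to f (z + c) - f z, with c = y - x, which is of
size |c| by [cauchy_lipschitz]. In particular a map that is complex
differentiable at each point is continuously differentiable. *)
Lemma cauchy_diff_lipschitz f x rho M y h : 0 < rho ->
  (forall y, nrm (y - x) < rho -> differentiable f y /\ nrm (f y) <= M) ->
  nrm (y - x) < rho / 4 ->
  nrm ('d f y h - 'd f x h) <= 288 * M / rho ^+ 2 * nrm (y - x) * nrm h.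
Proof.
move=> r0 hf hy; pose c := y - x.
have B (z : E) : nrm (z - x) < rho / 4 -> nrm (z + c - x) < rho / 2.
  by move=> hz; rewrite addrAC; apply: le_lt_trans (nrmD _ _) _; rewrite /c; lra.
have yE : x + c = y by rewrite /c addrC subrK.
have D (z : E) : nrm (z - x) < rho / 4 ->
    differentiable (fun w => f (w + c) - f w) z /\
    nrm (f (z + c) - f z) <= 12 * M / rho * nrm c.
  move=> hz; have hz' := B _ hz.
  split; last first.
    have := cauchy_lipschitz r0 hf (y := z + c) (z := z) hz'.
    by rewrite [z + c - z]addrAC subrr add0r; apply; lra.
  apply: (diff_sub _ _).1; first apply: (diff_shift _).1.
    by apply: (hf _ _).1; lra.
  by apply: (hf _ _).1; lra.
have x1 : nrm (x - x) < rho / 4 by rewrite subrr nrm0 divr_gt0.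
have := @cauchy_estimate (fun w => f (w + c) - f w) x (rho / 4) _ h (divr_gt0 r0 (ltr0Sn _ 3)) D.
have dx : differentiable f (x + c) by rewrite yE; apply: (hf _ _).1; lra.
have dx' : differentiable f x by apply: (hf _ _).1; lra.
have [s1 s2] := diff_shift dx; have [_ E1] := diff_sub s1 dx'.
have E2 := etrans (E1 h) (congr1 (fun k : E -> V => k h - 'd f x h) s2).
rewrite -[in 'd f y]yE -E2 => /le_trans; apply.
rewrite le_eqVlt; apply/orP; left; apply/eqP; rewrite /c.
by field; rewrite gt_eqF.
Qed.

Lemma diff_lin_id (L : {linear E -> V}) x : continuous L ->
  differentiable L x /\ 'd L x = L :> (E -> V).
Proof.
by move=> cL; split; [exact: linear_differentiable | exact: diff_lin].
Qed.

(** Mean value inequality for f minus its differential at x, whose derivative is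
small by [cauchy_diff_lipschitz]. The point of the explicit constant is
uniformity: it depends on f only through the bound M. *)
Lemma cauchy_quadratic f x rho M h : 0 < rho ->
  (forall y, nrm (y - x) < rho -> differentiable f y /\ nrm (f y) <= M) ->
  nrm h < rho / 4 ->
  nrm (f (x + h) - f x - 'd f x h) <= 288 * M / rho ^+ 2 * nrm h ^+ 2.
Proof.
move=> r0 hf hh.
have M0 : 0 <= M.
  by have := hf x; rewrite subrr nrm0 => /(_ r0)[_]; apply: le_trans; apply: nrm_ge0.
have dx : differentiable f x by apply: (hf _ _).1; rewrite subrr nrm0.
have -> : f (x + h) - f x - 'd f x h = f (x + h) - 'd f x (x + h) - (f x - 'd f x x).
  rewrite linearD; move: (f (x + h)) (f x) ('d f x x) ('d f x h) => a b p q /=.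
  by rewrite opprB opprD !addrA [RHS](ACl (1*5*3*(2*4))) /= addNr addr0.
apply: (@mvt_line (fun y => f y - 'd f x y)).
move=> t ht.
  have hth : nrm (x + t *: h - x) <= nrm h.
    by rewrite addrC addKr nrmZ ler_piMl ?nrm_ge0 // nrm_segment.
  have dt : differentiable f (x + t *: h) by apply: (hf _ _).1; lra.
  have [d1 d2] := diff_lin_id (x + t *: h) (diff_continuous dx).
  have [e1 e2] := diff_sub dt d1; split => //.
  have e3 := etrans (e2 h) (congr1 (fun k : E -> V => 'd f (x + t *: h) h - k h) d2).
  rewrite e3.
  apply: le_trans (cauchy_diff_lipschitz _ r0 hf _) _; first lra.
  rewrite (expr2 (nrm h)) mulrA; apply: ler_wpM2r; first exact: nrm_ge0.
  apply: ler_wpM2l hth; apply: divr_ge0; [exact: mulr_ge0 (ler0n _ 288) M0 | exact: sqr_ge0].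
Qed.

(** Holomorphy of the germ of f at x. *)
Definition hol f x := exists2 r : R, 0 < r & forall y, nrm (y - x) < r -> differentiable f y.

End SeveralVariables.

Section Weierstrass.
Variable R : realType.
Local Notation C := (Cx R).
Variables E V : normedModType C.
Implicit Types f : E -> V.

Lemma linear_of (L : E -> V) : (forall x y, L (x + y) = L x + L y) ->
  (forall (a : C) x, L (a *: x) = a *: L x) -> exists L' : {linear E -> V}, L' =1 L.
Proof.
move=> h1 h2; have ll : linear L by move=> a x y; rewrite h1 h2.
pose lM := GRing.isLinear.Build _ _ _ _ _ ll.
by exists (HB.pack L lM : {linear E -> V}).
Qed.

(** By the Cauchy estimate the differentials form a Cauchy sequence, and
[cauchy_quadratic] gives first-order expansions of the f_k with a common error
term, which pass to the limit. *)
Lemma weierstrass (fk : nat -> E -> V) f x rho : complete_nrm V -> 0 < rho ->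
  (forall k y, nrm (y - x) < rho -> differentiable (fk k) y) ->
  (forall e, 0 < e -> exists N, forall k y, (N <= k)%N -> nrm (y - x) < rho ->
     nrm (fk k y - f y) <= e) ->
  differentiable f x /\ forall h, tends (fun k => 'd (fk k) x h) ('d f x h).
Proof.
move=> cV r0 dk ck.
have [N0 hN0] := ck 1 ltr01.
have xx : nrm (x - x) < rho by rewrite subrr nrm0.
(* A common bound M on a smaller ball, from the continuity of one f_k. *)
have [d d0 hd] : exists2 d : R, 0 < d & forall y, nrm (y - x) < d ->
    nrm (fk N0 y - fk N0 x) < 1.
  by apply: (cont_nrm (fk N0) x).1 => //; apply: differentiable_continuous; apply: dk.
pose r := Num.min d rho; have rp : 0 < r by rewrite lt_min d0.
pose M := nrm (fk N0 x) + 3.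
have B k y : (N0 <= k)%N -> nrm (y - x) < r -> differentiable (fk k) y /\ nrm (fk k y) <= M.
  rewrite lt_min => Nk /andP[y1 y2]; split; first exact: dk.
  have := nrm_trir (fk k y) (f y); have := nrm_trir (f y) (fk N0 y).
  have := nrm_trir (fk N0 y) (fk N0 x); have := hd _ y1.
  have := hN0 _ _ Nk y2; have := hN0 _ _ (leqnn _) y2.
  by rewrite (nrmBC (f y)) /M; lra.
have cd h : cauchyS (fun k => 'd (fk k) x h).
  move=> e e0; pose c := 12 / r * nrm h + 1.
  have c0 : 0 < c by rewrite ltr_wpDl // mulr_ge0 ?nrm_ge0 // divr_ge0 // ltW.
  have [N hN] := ck (e / c) (divr_gt0 e0 c0).
  exists N => k l Nk Nl.
  have D y : nrm (y - x) < r -> differentiable (fun z => fk k z - fk l z) y /\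
      nrm (fk k y - fk l y) <= 2 * (e / c).
    rewrite lt_min => /andP[_ y2]; split; first exact: (diff_sub (dk _ _ y2) (dk _ _ y2)).1.
    have := nrm_tri (fk k y) (f y) (fk l y); have := hN _ _ Nk y2; have := hN _ _ Nl y2.
    by rewrite (nrmBC (f y)); lra.
  rewrite -((diff_sub (dk k _ xx) (dk l _ xx)).2 h).
  apply: le_trans (cauchy_estimate h rp D) _.
  have -> : 6 * (2 * (e / c)) / r * nrm h = (12 / r * nrm h) * (e / c).
    by field; rewrite !gt_eqF.
  have -> : 12 / r * nrm h = c - 1 by rewrite /c addrK.
  have : c * (e / c) = e by field; rewrite gt_eqF.
  have := divr_gt0 e0 c0; lra.
have [L hL] := choice (fun h => cV _ (cd h)).
have [L' L'E] : exists L' : {linear E -> V}, L' =1 L.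
  apply: linear_of => [h1 h2|a h].
    apply: tends_uniq (hL _) _; have := tendsD (hL h1) (hL h2).
    by congr (tends _ _); apply/funext => k; rewrite linearD.
  apply: tends_uniq (hL _) _; have := tendsZ a (hL h).
  by congr (tends _ _); apply/funext => k; rewrite linearZ.
have Lb h : nrm (L' h) <= 6 * M / r * nrm h.
  rewrite L'E -[L h]subr0; apply: (tends_le (N := N0) (hL h)) => k Nk.
  by rewrite subr0; apply: cauchy_estimate rp (fun y => B k y Nk).
have fl y : nrm (y - x) < rho -> tends (fun k => fk k y) (f y).
  by move=> hy e /ck[N hN]; exists N => k Nk; exact: hN.
have Q y : nrm (y - x) < r / 4 ->
    nrm (f y - f x - L' (y - x)) <= 288 * M / r ^+ 2 * nrm (y - x) ^+ 2.
  move=> hy; rewrite L'E -[X in nrm X]subr0.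
  apply: (tends_le (N := N0) (u := fun k => fk k y - fk k x - 'd (fk k) x (y - x))).
    have y2 : nrm (y - x) < rho.
      have : r <= rho by rewrite ge_min lexx orbT.
      lra.
    have t1 := tendsZ (-1) (fl _ xx); have t2 := tendsZ (-1) (hL (y - x)).
    have := tendsD (tendsD (fl _ y2) t1) t2.
    by rewrite !scaleN1r; congr (tends _ _); apply/funext => k; rewrite !scaleN1r.
  move=> k Nk; rewrite subr0.
  have := cauchy_quadratic rp (fun y => B k y Nk) hy.
  by rewrite [x + _]addrC subrK.
have [df dfE] : differentiable f x /\ 'd f x = L' :> (E -> V).
  apply: nrm_diff; first exact: bound_continuous Lb.
  move=> e e0; pose c := 288 * M / r ^+ 2.
  have c0 : 0 <= c.
    apply: divr_ge0 (sqr_ge0 _); apply: (mulr_ge0 (ler0n _ 288)).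
    exact: addr_ge0 (nrm_ge0 _) (ler0n _ 3).
  have c1 : 0 < c + 1 by rewrite ltr_wpDl.
  exists (Num.min (r / 4) (e / (c + 1))); first by rewrite lt_min !divr_gt0.
  move=> y; rewrite lt_min => /andP[/Q h1 h2]; apply: le_trans h1 _.
  rewrite -/c expr2 mulrA ler_wpM2r ?nrm_ge0 //.
  move: h2; rewrite ltr_pdivlMr // => /ltW; apply: le_trans.
  have := nrm_ge0 (y - x); lra.
split => // h; have := hL h.
by rewrite -(etrans (congr1 (fun k : E -> V => k h) dfE) (L'E h)).
Qed.

Lemma hol_near f x : hol f x -> exists2 r : R, 0 < r & forall y, nrm (y - x) < r -> hol f y.
Proof.
move=> [r r0 h]; exists (r / 2) => [|y hy]; first by rewrite divr_gt0.
exists (r / 2) => [|z hz]; first by rewrite divr_gt0.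
by apply: h; have := nrm_tri z y x; lra.
Qed.

Lemma hol_diff f x : hol f x -> differentiable f x.
Proof. by move=> [r r0]; apply; rewrite subrr nrm0. Qed.

Lemma hol_bounded f x : hol f x -> exists r M : R, 0 < r /\
  forall y, nrm (y - x) < r -> differentiable f y /\ nrm (f y) <= M.
Proof.
move=> hf; have df := hol_diff hf; case: hf => r r0 h.
have [d d0 hd] := (cont_nrm f x).1 (differentiable_continuous df) 1 ltr01.
exists (Num.min d r), (nrm (f x) + 1); split; first by rewrite lt_min d0.
move=> y; rewrite lt_min => /andP[/hd y1 /h y2]; split => //.
have := nrm_trir (f y) (f x); lra.
Qed.

(** The derivative along v is the uniform limit of the difference quotients with
increments s_k v, s_k = c 2^-k, by [cauchy_quadratic]. *)
Lemma diff_dir f x v : complete_nrm V -> hol f x -> differentiable (fun y => 'd f y v) x.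
Proof.
move=> cV /hol_bounded[r [M [r0 hf]]].
have B y : nrm (y - x) < r / 2 -> forall z, nrm (z - y) < r / 2 ->
    differentiable f z /\ nrm (f z) <= M.
  by move=> hy z hz; apply: hf; have := nrm_tri z y x; lra.
(* c keeps the increments s k *: v shorter than r / 8. *)
pose c := r / 16 / (nrm v + 1).
have v1 : 0 < nrm v + 1 by rewrite ltr_wpDl // nrm_ge0.
have c0 : 0 < c by rewrite !divr_gt0.
have cv : c * nrm v < r / 8.
  rewrite /c mulrAC ltr_pdivrMr //; have := nrm_ge0 v; nra.
pose s k : C := toC (c * 2^-1 ^+ k).
have s0 k : s k != 0 by rewrite toC_eq0 gt_eqF // mulr_gt0 // expr_half_gt0.
have ns k : nrm (s k) = c * 2^-1 ^+ k.
  by rewrite nrm_toC ger0_norm // mulr_ge0 ?ltW // expr_half_gt0.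
have sv k : nrm (s k *: v) < r / 8.
  rewrite nrmZ ns; have := expr_half_le1 R k; have := expr_half_ge0 R k.
  move: (2^-1 ^+ k) => h h0 h1; apply: le_lt_trans cv.
  by rewrite mulrAC ler_piMr // mulr_ge0 ?nrm_ge0 // ltW.
apply: (@weierstrass (fun k y => (s k)^-1 *: (f (y + s k *: v) - f y)) _ x (r / 2) cV _ _ _).1.
- by rewrite divr_gt0.
- move=> k y hy; apply: (@differentiableZ _ _ _ (fun y => f (y + s k *: v) - f y)).
  apply: (diff_sub _ _).1; last by apply: (hf _ _).1; lra.
  apply: (diff_shift _).1; apply: (hf _ _).1.
  rewrite addrAC; apply: le_lt_trans (nrmD _ _) _; have := sv k; lra.
- move=> e e0; have r20 : 0 < r / 2 by rewrite divr_gt0.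
  have [N hN] := expr_half_small (288 * M / (r / 2) ^+ 2 * nrm v ^+ 2 * c) e0.
  exists N => k y /hN Nk hy; apply: le_trans Nk.
  have q := cauchy_quadratic r20 (B y hy) (h := s k *: v).
  have {}q := q ltac:(have := sv k; lra).
  have -> : (s k)^-1 *: (f (y + s k *: v) - f y) - 'd f y v =
     (s k)^-1 *: (f (y + s k *: v) - f y - 'd f y (s k *: v)).
    have -> : 'd f y (s k *: v) = s k *: 'd f y v by exact: linearZ.
    by rewrite [RHS]scalerBr scalerA mulVf // scale1r.
  rewrite nrmZ nrmV ns; rewrite nrmZ ns in q.
  have hp := expr_half_gt0 R k; move: (2^-1 ^+ k) hp q => h hp q.
  rewrite (ler_pdivrMl _ _ (mulr_gt0 c0 hp)); apply: le_trans q _.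
  by rewrite le_eqVlt; apply/orP; left; apply/eqP; ring.
Qed.

End Weierstrass.

Section Symmetry.
Variable R : realType.
Local Notation C := (Cx R).
Variables E V : normedModType C.
Implicit Types f : E -> V.

Lemma le_eq_trans (a b c : R) : a = b -> b <= c -> a <= c.
Proof. by move=> ->. Qed.

Lemma second_difference_bound (s e U U' z a b : R) : 0 < s -> 0 < e ->
  z <= e * a + e * b -> a <= s * (U + U') -> b <= s * U' ->
  s * z <= e * s ^+ 2 * (U + 2 * U').
Proof.
move=> s0 e0 hz ha hb.
have hab := ler_wpM2l (ltW e0) (lerD ha hb); rewrite mulrDr in hab.
apply: le_trans (ler_wpM2l (ltW s0) (le_trans hz hab)) _.
by rewrite le_eqVlt; apply/orP; left; apply/eqP; ring.
Qed.

(** The second difference with steps s u and s v is the increment, over the second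
step, of a function of one variable whose derivative is s times a first
difference of the derivative of f along v. *)
Lemma second_difference f x u v : complete_nrm V -> hol f x -> forall e, 0 < e ->
  exists2 d : R, 0 < d & forall s, 0 < s -> s < d ->
  nrm (f (x + toC s *: u + toC s *: v) - f (x + toC s *: u) - (f (x + toC s *: v) - f x) -
       (toC s * toC s) *: 'd (fun y => 'd f y v) x u) <= e * s ^+ 2 * (nrm u + 2 * nrm v).
Proof.
move=> cV hf e e0; have dFv := diff_dir v cV hf.
have [d d0 hd] := diff_nrm dFv e0; case: hf => r r0 hr.
move: ('d (fun y => 'd f y v) x) hd => L hd; set D := L u.
have c0 : 0 < nrm u + 2 * nrm v + 1 by rewrite ltr_wpDl // addr_ge0 ?mulr_ge0 ?nrm_ge0.
exists (Num.min r d / (nrm u + 2 * nrm v + 1)); first by rewrite divr_gt0 // lt_min r0.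
move=> s s0; rewrite ltr_pdivlMr // lt_min => /andP[sr sd].
have nS : nrm (toC s) = s by rewrite nrm_toC gtr0_norm.
have nu := nrm_ge0 u; have nv := nrm_ge0 v.
have W1 t : unit_segment t -> nrm (toC s *: u + t *: (toC s *: v)) <= s * (nrm u + nrm v).
  move=> /nrm_segment ht; apply: le_trans (nrmD _ _) _; rewrite !nrmZ nS mulrDr lerD2l.
  by rewrite ler_piMl // mulr_ge0 // ltW.
have W2 t : unit_segment t -> nrm (t *: (toC s *: v)) <= s * nrm v.
  move=> /nrm_segment ht; rewrite !nrmZ nS.
  by rewrite ler_piMl // mulr_ge0 // ltW.
have W t : unit_segment t -> nrm (toC s *: u + t *: (toC s *: v)) < Num.min r d /\
    nrm (t *: (toC s *: v)) < Num.min r d.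
  have cs : s * (nrm u + nrm v) < Num.min r d /\ s * nrm v < Num.min r d.
    rewrite !lt_min; split; apply/andP; split; (apply: le_lt_trans; last by [exact: sr |
        exact: sd]);
      apply: ler_wpM2l; rewrite ?(ltW s0) //; lra.
  by move=> ht; split; [exact: le_lt_trans (W1 t ht) cs.1 | exact: le_lt_trans (W2 t ht) cs.2].
pose k (t : C) := f (x + toC s *: u + t *: (toC s *: v)) - f (x + t *: (toC s *: v)).
have dk t : unit_segment t -> differentiable k t /\
    'd k t 1 = 'd f (x + toC s *: u + t *: (toC s *: v)) (toC s *: v) -
               'd f (x + t *: (toC s *: v)) (toC s *: v).
  move=> /W[]; rewrite !lt_min => /andP[w1 _] /andP[w2 _].
  have d1 : differentiable f (x + toC s *: u + t *: (toC s *: v)).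
    by apply: hr; rewrite -[X in nrm (X - _)]addrA addrAC subrr add0r.
  have d2 : differentiable f (x + t *: (toC s *: v)).
    by apply: hr; rewrite addrAC subrr add0r.
  have [a1 b1] := diff_line d1; have [a2 b2] := diff_line d2.
  have [a3 b3] := diff_sub a1 a2.
  by split => //; rewrite -b1 -b2; exact: (b3 1).
have dZ (w : V) (t : C) : differentiable (fun t : C => t *: w) t /\ 'd (fun t : C => t *:
    w) t 1 = w.
  have ll : linear (fun s : C => s *: w) by move=> a b c; rewrite scalerDl scalerA.
  pose lM := GRing.isLinear.Build _ _ _ _ _ ll.
  pose L' : {linear C -> V} := HB.pack (fun s : C => s *: w) lM.
  have cl : continuous L' by exact: scalel_continuous.
  have [a b] := diff_lin_id t cl; split; first exact: a.
  by rewrite (congr1 (fun k : C -> V => k 1) b) /L' /= scale1r.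
pose w := (toC s * toC s) *: D.
have := @mvt _ _ (fun t : C => k t - t *: w) (@unit_segment R)
  (e * s ^+ 2 * (nrm u + 2 * nrm v)) 0 1 (@unit_segment_mid R) (@unit_segment_closed R).
rewrite subr0 nrm1 mulr1 /k !scale1r !scale0r !addr0 subr0.
have -> : f (x + toC s *: u + toC s *: v) - f (x + toC s *: v) - w -
   (f (x + toC s *: u) - f x) = f (x + toC s *: u + toC s *: v) -
    f (x + toC s *: u) - (f (x + toC s *: v) - f x) - w.
  move: (f _) (f _) (f _) (f _) w => a b c d' w'; rewrite !opprB !addrA.
  by rewrite [LHS](ACl (1*5*4*2*3)).
apply; first last.
- by split => //=; rewrite ler01.
- by split => //=; rewrite ler01.
move=> t ht; have [a1 b1] := dk _ ht; have [a2 b2] := dZ w t.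
have [a3 b3] := diff_sub a1 a2; split; first exact: a3.
have E1 : 'd (fun z : C => k z - z *: w) t 1 = toC s *:
   ('d f (x + toC s *: u + t *: (toC s *: v)) v - 'd f (x + t *: (toC s *: v)) v - toC s *: D).
  apply: etrans (b3 1) _; apply: etrans (f_equal2 (fun a b => a - b) b1 b2) _.
  rewrite /w -scalerA !scalerBr.
  by congr (_ - _ - _); exact: linearZ.
apply: le_eq_trans (congr1 (@nrm R V) E1) _; rewrite nrmZ nS.
have [] := W t ht; rewrite !lt_min => /andP[_ w1] /andP[_ w2].
have q1 := hd (x + (toC s *: u + t *: (toC s *: v))); have q2 := hd (x + t *: (toC s *: v)).
have Z (z : E) : x + z - x = z by rewrite addrAC subrr add0r.
rewrite !Z in q1 q2; have {}q1 := q1 w1; have {}q2 := q2 w2; rewrite addrA in q1.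
have q3 := nrmB ('d f (x + toC s *: u + t *: (toC s *: v)) v - 'd f x v -
  L (toC s *: u + t *: (toC s *: v)))
  ('d f (x + t *: (toC s *: v)) v - 'd f x v - L (t *: (toC s *: v))).
have L1 : L (toC s *: u + t *: (toC s *: v)) = toC s *: D + L (t *: (toC s *: v)).
  by rewrite linearD; congr (_ + _); exact: linearZ.
rewrite L1 in q1 q3.
have E2 (a b c p q : V) : a - c - (p + q) - (b - c - q) = a - b - p.
  by rewrite !opprB !opprD !addrA [LHS](ACl ((1*7*3)*((2*6)*(4*5)))) /= addNr addNr !addr0.
rewrite E2 in q3; have {}q3 := le_trans q3 (lerD q1 q2).
exact: (second_difference_bound s0 e0 q3 (W1 t ht) (W2 t ht)).
Qed.

(** The second difference does not change when u and v are exchanged, and it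
determines the coefficient of s^2. *)
Lemma second_difference_limit f x u v (A B : V) (c c' : R) :
  (forall e, 0 < e -> exists2 d : R, 0 < d & forall s, 0 < s -> s < d ->
  nrm (f (x + toC s *: u + toC s *: v) - f (x + toC s *: u) - (f (x + toC s *: v) - f x) -
       (toC s * toC s) *: A) <= e * s ^+ 2 * c) ->
  (forall e, 0 < e -> exists2 d : R, 0 < d & forall s, 0 < s -> s < d ->
  nrm (f (x + toC s *: v + toC s *: u) - f (x + toC s *: v) - (f (x + toC s *: u) - f x) -
       (toC s * toC s) *: B) <= e * s ^+ 2 * c') -> A = B.
Proof.
move=> h1 h2; apply: subr0_eq; apply: nrm_eq0; apply/eqP.
rewrite eq_le nrm_ge0 andbT.
apply: (@le_eps _ _ 0 (c + c')) => e e0.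
have [d d0 hd] := h1 e e0; have [d' d'0 hd'] := h2 e e0.
pose s := Num.min d d' / 2.
have m0 : 0 < Num.min d d' by rewrite lt_min d0.
have s0 : 0 < s by rewrite divr_gt0.
have sm : s < Num.min d d' by rewrite /s; lra.
move: sm; rewrite lt_min => /andP[sd sd'].
move: (hd _ s0 sd) (hd' _ s0 sd'); rewrite [x + _ *: v + _]addrAC.
move: (f _) (f _) (f _) (f _) => a b p q q1 q2.
have E1 : q - b - (p - a) - (toC s * toC s) *: B - (q - p - (b - a) - (toC s * toC s) *: A)
   = (toC s * toC s) *: (A - B).
  rewrite scalerBr; move: (_ *: A) (_ *: B) => A' B'.
  rewrite !opprB !addrA [LHS](ACl (6*5*((1*10)*(2*7)*(3*8)*(4*9)))) /=.
  by rewrite !subrr !addNr !addr0.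
have := le_trans (nrmB _ _) (lerD q2 q1).
rewrite E1 nrmZ nrmM nrm_toC (gtr0_norm s0) -mulrDr => q3.
have s2 : 0 < s * s by rewrite mulr_gt0.
rewrite -(ler_pM2l s2) add0r; apply: le_trans q3 _.
by rewrite expr2 le_eqVlt; apply/orP; left; apply/eqP; ring.
Qed.

Lemma diff_sym f x u v : complete_nrm V -> hol f x ->
  'd (fun y => 'd f y v) x u = 'd (fun y => 'd f y u) x v.
Proof.
move=> cV hf.
exact: (second_difference_limit (second_difference u v cV hf) (second_difference v u cV hf)).
Qed.

End Symmetry.

(** * Flows of holomorphic vector fields *)
Section Flow.
Variable R : realType.
Local Notation C := (Cx R).

Section Prod.
Variables E V : normedModType C.

Lemma nrm_pair (p : E * V) : nrm p = Num.max (nrm p.1) (nrm p.2).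
Proof.
apply: toC_inj; rewrite -nrmE prod_normE !nrmE [in LHS]/Order.max toC_lt.
by rewrite /Order.max; case: ifP.
Qed.

Lemma nrm_fst (p : E * V) : nrm p.1 <= nrm p.
Proof. by rewrite nrm_pair le_max lexx. Qed.

Lemma nrm_snd (p : E * V) : nrm p.2 <= nrm p.
Proof. by rewrite nrm_pair le_max lexx orbT. Qed.

Lemma diff_fst (p : E * V) : differentiable (fun p : E * V => p.1) p.
Proof.
have ll : linear (fun p : E * V => p.1) by move=> a x y.
pose lM := GRing.isLinear.Build _ _ _ _ _ ll.
pose L : {linear (E * V)%type -> E} := HB.pack (fun p : E * V => p.1) lM.
apply: (@linear_differentiable _ _ _ L).
by apply: (@bound_continuous _ _ _ L 1) => x; rewrite mul1r /L; exact: nrm_fst.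
Qed.

Lemma diff_snd (p : E * V) : differentiable (fun p : E * V => p.2) p.
Proof.
have ll : linear (fun p : E * V => p.2) by move=> a x y.
pose lM := GRing.isLinear.Build _ _ _ _ _ ll.
pose L : {linear (E * V)%type -> V} := HB.pack (fun p : E * V => p.2) lM.
apply: (@linear_differentiable _ _ _ L).
by apply: (@bound_continuous _ _ _ L 1) => x; rewrite mul1r /L; exact: nrm_snd.
Qed.

Lemma diff_mid (a b : E -> C) e0 : differentiable a e0 -> differentiable b e0 ->
  differentiable (fun e => mid (a e) (b e)) e0.
Proof.
move=> da db.
have -> : (fun e => mid (a e) (b e)) = (fun e => 2^-1 *: (a e + b e)).
  by apply/funext => e; rewrite /mid mulrC.
apply: (@differentiableZ _ _ _ (fun e => a e + b e)); exact: differentiableD.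
Qed.

Lemma diff_id (x : E) : differentiable (fun e : E => e) x.
Proof. by apply: (@linear_differentiable _ _ _ idfun) => y. Qed.

(** A midpoint sum with holomorphic dependence on a parameter is a finite sum of
holomorphic functions of the parameter. *)
Lemma diff_msum (H : C * E -> V) (a b : E -> C) K k e0 : mid_closed K ->
  (forall s, K s -> differentiable H (s, e0)) -> K (a e0) -> K (b e0) ->
  differentiable a e0 -> differentiable b e0 ->
  differentiable (fun e => msum (fun s => H (s, e)) k (a e) (b e)) e0.
Proof.
move=> Km dH; elim: k a b => [|k IH] a b Ka Kb da db /=.
  have Kc := Km _ _ Ka Kb.
  apply: differentiable_scale; first exact: (diff_sub db da).1.
  exact: (differentiable_comp (differentiable_pair (diff_mid da db) (diff_id e0)) (dH _ Kc)).
have Kc := Km _ _ Ka Kb; have dm := diff_mid da db.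
apply: differentiableD; exact: IH.
Qed.

End Prod.

Variable V : normedModType C.

(** This is what keeps the Picard iterates Lipschitz in time with a constant that
does not depend on the iterate. *)
Lemma msum_endpoints (f : C -> V) K M L d k a b a' b' : mid_closed K ->
  (forall z, K z -> nrm (f z) <= M) ->
  (forall z w, K z -> K w -> nrm (f z - f w) <= L * nrm (z - w)) -> 0 <= L ->
  K a -> K b -> K a' -> K b' -> nrm (a - a') <= d -> nrm (b - b') <= d ->
  nrm (msum f k a b - msum f k a' b') <=
    M * nrm (b - a - (b' - a')) + L * d * nrm (b' - a').
Proof.
move=> Km hM hL L0; elim: k a b a' b' => [|k IH] a b a' b' Ka Kb Ka' Kb' ha hb.
  have Kc := Km _ _ Ka Kb; have Kc' := Km _ _ Ka' Kb'.
  have -> : msum f 0 a b - msum f 0 a' b' =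
    (b - a - (b' - a')) *: f (mid a b) + (b' - a') *: (f (mid a b) - f (mid a' b')).
    rewrite /= [in RHS]scalerBl [in RHS]scalerBr.
    by rewrite addrA subrK.
  apply: le_trans (nrmD _ _) _; rewrite 2!(nrmZ (_ - _)); apply: lerD.
    by rewrite mulrC ler_wpM2r ?nrm_ge0 // hM.
  rewrite mulrC ler_wpM2r ?nrm_ge0 //; apply: le_trans (hL _ _ Kc Kc') _.
  apply: ler_wpM2l => //.
  have -> : mid a b - mid a' b' = ((a - a') + (b - b')) / 2 by rewrite /mid; field.
  by rewrite nrm_half; have := nrmD (a - a') (b - b'); lra.
have Kc := Km _ _ Ka Kb; have Kc' := Km _ _ Ka' Kb'.
have hm : nrm (mid a b - mid a' b') <= d.
  have -> : mid a b - mid a' b' = ((a - a') + (b - b')) / 2 by rewrite /mid; field.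
  by rewrite nrm_half; have := nrmD (a - a') (b - b'); lra.
rewrite /= opprD addrACA; apply: le_trans (nrmD _ _) _.
apply: le_trans (lerD (IH _ _ _ _ Ka Kc Ka' Kc' ha hm) (IH _ _ _ _ Kc Kb Kc' Kb' hm hb)) _.
have -> : mid a b - a - (mid a' b' - a') = (b - a - (b' - a')) / 2 by rewrite /mid; field.
have -> : b - mid a b - (b' - mid a' b') = (b - a - (b' - a')) / 2 by rewrite /mid; field.
by rewrite mid_subl mid_subr !nrm_half; lra.
Qed.

(** Picard iteration for F' = X(F), F(0) = q, in which the k-th iterate uses the
midpoint sum of level k for the integral: one sequence, of maps which are
holomorphic in (t, q), takes care of both limits. *)
Fixpoint picard (X : V -> V) k (t : C) (q : V) : V :=
  if k is k'.+1 then q + msum (fun s => X (picard X k' s q)) k' 0 t else q.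

Section Picard.
Variables (X : V -> V) (q0 : V) (rho M L T : R).
Hypothesis X_diff : forall y, nrm (y - q0) < rho -> differentiable X y.
Hypothesis X_bound : forall y, nrm (y - q0) < rho -> nrm (X y) <= M.
Hypothesis X_lip : forall y z, nrm (y - q0) < rho -> nrm (z - q0) < rho ->
  nrm (X y - X z) <= L * nrm (y - z).
Hypotheses (M0 : 0 <= M) (L0 : 0 <= L) (T0 : 0 < T) (rho0 : 0 < rho).
Hypotheses (TM : T * M <= rho / 4) (TL : T * L <= 1 / 4).

Let K : set C := [set t | nrm t < T].
Let Km : mid_closed K.
Proof.
move=> a b; rewrite /K /= => ha hb; rewrite /mid nrm_half.
by have := nrmD a b; lra.
Qed.
Let K0 : K 0. Proof. by rewrite /K /= nrm0. Qed.

Let near_q0 q y : nrm (q - q0) < rho / 2 -> nrm (y - q) <= T * M -> nrm (y - q0) < rho.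
Proof. by move=> h1 h2; have := nrm_tri y q q0; move: TM rho0 h1 h2; lra. Qed.

Lemma picard_bound k t q : K t -> nrm (q - q0) < rho / 2 ->
  nrm (picard X k t q - q) <= T * M.
Proof.
move=> + hq; elim: k t => [|k IH] t Kt /=; first by rewrite subrr nrm0 mulr_ge0 // ltW.
rewrite addrC addKr.
apply: le_trans (@msum_bound _ _ (fun s => X (picard X k s q)) K M k 0 t Km _ K0 Kt) _.
  by move=> z Kz; apply: X_bound; apply: near_q0 hq (IH _ Kz).
by rewrite subr0 mulrC ler_wpM2r // ltW.
Qed.

Lemma picard_near k t q : K t -> nrm (q - q0) < rho / 2 -> nrm (picard X k t q - q0) < rho.
Proof. by move=> Kt hq; apply: near_q0 hq (picard_bound k Kt hq). Qed.

(** Needed to bound the quadrature error in [picard_step]; the constant 2 M is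
reproduced by the iteration because T L <= 1/4. *)
Lemma picard_lip k t t' q : K t -> K t' -> nrm (q - q0) < rho / 2 ->
  nrm (picard X k t q - picard X k t' q) <= 2 * M * nrm (t - t').
Proof.
move=> + + hq; elim: k t t' => [|k IH] t t' Kt Kt' /=.
  by rewrite subrr nrm0 !mulr_ge0 ?nrm_ge0.
rewrite opprD addrACA subrr add0r.
apply: le_trans (@msum_endpoints (fun s => X (picard X k s q)) K M (L * (2 * M))
   (nrm (t - t')) k 0 t 0 t' Km _ _ _ K0 Kt K0 Kt' _ (lexx _)) _.
- by move=> z Kz; apply: X_bound; exact: picard_near.
- move=> z w Kz Kw; apply: le_trans (X_lip _ _) _; try exact: picard_near.
  by rewrite -mulrA ler_wpM2l // IH.
- by rewrite !mulr_ge0.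
- by rewrite subrr nrm0 nrm_ge0.
rewrite !subr0.
have n0 := nrm_ge0 (t - t'); have p0 := nrm_ge0 t'.
have Mn : 0 <= M * nrm (t - t') by rewrite mulr_ge0.
have LT : L * nrm t' <= 1 / 4.
  by apply: le_trans TL; rewrite mulrC ler_wpM2r // ltW.
have := ler_wpM2l Mn LT; lra.
Qed.

Lemma picard_diff k t q : K t -> nrm (q - q0) < rho / 2 ->
  differentiable (fun p : C * V => picard X k p.1 p.2) (t, q).
Proof.
move=> + hq; elim: k t => [|k IH] t Kt /=; first exact: diff_snd.
apply: differentiableD; first exact: diff_snd.
apply: (@diff_msum _ _ (fun z : C * (C * V) => X (picard X k z.1 z.2.2)) (fun=> 0) (fun p
    => p.1) K) => //.
  move=> s Ks.
  have d1 : differentiable (fun z : C * (C * V) => (z.1, z.2.2)) (s, (t, q)).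
    apply: differentiable_pair; first exact: diff_fst.
    exact: (differentiable_comp (diff_snd _) (diff_snd _)).
  have d2 := differentiable_comp d1 (IH s Ks).
  by apply: (differentiable_comp d2); apply: X_diff; exact: picard_near.
exact: diff_fst.
Qed.

(** Contraction, with factor T L <= 1/4, against a quadrature error of order 2^-k:
together they leave a geometric rate 1/2. *)
Lemma picard_step k t q : K t -> nrm (q - q0) < rho / 2 ->
  nrm (picard X k.+1 t q - picard X k t q) <= 2 * M * T * 2^-1 ^+ k.
Proof.
move=> + hq; elim: k t => [|k IH] t Kt.
  have := picard_bound 1 Kt hq; rewrite expr0 mulr1 [picard X 0 _ _]/=.
  have : 0 <= T * M by rewrite mulr_ge0 // ltW.
  lra.
have -> : picard X k.+2 t q - picard X k.+1 t q =
  msum (fun s => X (picard X k.+1 s q) - X (picard X k s q)) k.+1 0 t +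
  (msum (fun s => X (picard X k s q)) k.+1 0 t - msum (fun s => X (picard X k s q)) k 0 t).
  rewrite msumB subrKA [picard X k.+2 _ _]/= -/(picard X k.+1 t q).
  rewrite -/(msum (fun s => X (picard X k.+1 s q)) k.+1 0 t).
  rewrite [picard X k.+1 t q]/= opprD addrACA subrr add0r //.
apply: le_trans (nrmD _ _) _; apply: le_trans (lerD _ _) (_ : L * (2 * M * T * 2^-1 ^+ k) *
    T + (L * (2 * M)) * T ^+ 2 * 2^-1 ^+ k <= _).
- apply: le_trans (@msum_bound _ _ (fun s => X (picard X k.+1 s q) - X (picard X k s q)) K
    (L * (2 * M * T * 2^-1 ^+ k)) k.+1 0 t Km _ K0 Kt) _.
    move=> z Kz; apply: le_trans (X_lip _ _) _; try exact: picard_near.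
    by rewrite ler_wpM2l // IH.
  rewrite subr0; apply: ler_wpM2l; last exact: ltW Kt.
  by rewrite !mulr_ge0 ?expr_half_ge0 ?(ltW T0).
- apply: le_trans (@msum_refine _ _ (fun s => X (picard X k s q)) K (L * (2 * M)) k 0 t Km
    _ _ K0 Kt) _.
  + move=> z w Kz Kw; apply: le_trans (X_lip _ _) _; try exact: picard_near.
    by rewrite -mulrA ler_wpM2l // picard_lip.
  + by rewrite !mulr_ge0.
  + rewrite subr0; apply: ler_wpM2r; first exact: expr_half_ge0.
    apply: ler_wpM2l; first by rewrite !mulr_ge0.
    by rewrite ler_sqr ?nnegrE ?nrm_ge0 ?(ltW T0) ?(ltW Kt).
rewrite (exprS 2^-1); have := expr_half_ge0 R k; move: (2^-1 ^+ k) => h h0.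
have A0 : 0 <= M * T * h by rewrite !mulr_ge0 // ltW.
have := ler_wpM2l A0 TL; rewrite expr2; lra.
Qed.

Hypothesis cV : complete_nrm V.

Lemma picard_cvg : exists F : C * V -> V, forall t q k, nrm t < T -> nrm (q - q0) < rho / 2 ->
  nrm (picard X k t q - F (t, q)) <= 4 * M * T * 2^-1 ^+ k.
Proof.
have H (p : C * V) : exists l, nrm p.1 < T -> nrm (p.2 - q0) < rho / 2 -> forall k,
    nrm (picard X k p.1 p.2 - l) <= 4 * M * T * 2^-1 ^+ k.
  case: (pselect (nrm p.1 < T /\ nrm (p.2 - q0) < rho / 2)) => [[h1 h2]|h]; last first.
    by exists 0 => h1 h2; case: h.
  have [l hl] := geo_lim cV (fun k => picard_step k h1 h2).
  exists l => _ _ k; apply: le_trans (hl k) _.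
  by rewrite le_eqVlt; apply/orP; left; apply/eqP; ring.
by have [F hF] := choice H; exists F => t q k h1 h2; exact: (hF (t, q) h1 h2 k).
Qed.

Section Limit.
Variable F : C * V -> V.
Hypothesis hF : forall t q k, nrm t < T -> nrm (q - q0) < rho / 2 ->
  nrm (picard X k t q - F (t, q)) <= 4 * M * T * 2^-1 ^+ k.

Lemma flow_tends t q : nrm t < T -> nrm (q - q0) < rho / 2 ->
  tends (fun k => picard X k t q) (F (t, q)).
Proof.
move=> h1 h2 e /(expr_half_small (4 * M * T))[N hN]; exists N => k /hN.
by apply: le_trans; exact: hF.
Qed.

Lemma flow_near t q : nrm t < T -> nrm (q - q0) < rho / 2 -> nrm (F (t, q) - q) <= T * M.
Proof.
move=> h1 h2; apply: (tends_le (N := 0%N) (flow_tends h1 h2)) => k _.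
exact: picard_bound.
Qed.

Lemma flow_diff t q : nrm t < T -> nrm (q - q0) < rho / 2 -> differentiable F (t, q).
Proof.
move=> h1 h2; pose r := Num.min (T - nrm t) (rho / 2 - nrm (q - q0)).
have r0 : 0 < r by rewrite lt_min !subr_gt0 h1.
have B (p : C * V) : nrm (p - (t, q)) < r -> nrm p.1 < T /\ nrm (p.2 - q0) < rho / 2.
  move=> hp; have := le_lt_trans (nrm_fst _) hp; have := le_lt_trans (nrm_snd _) hp.
  rewrite !lt_min /= => /andP[_ p2] /andP[p1 _].
  have := nrm_trir p.1 t; have := nrm_tri p.2 q q0.
  by move=> *; split; lra.
apply: (@weierstrass _ _ _ (fun k p => picard X k p.1 p.2) F (t, q) r cV r0 _ _).1.
  by move=> k [t' q'] /B[b1 b2]; exact: picard_diff.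
move=> e /(expr_half_small (4 * M * T))[N hN]; exists N => k [t' q'] /hN + /B[b1 b2].
by apply: le_trans; exact: hF.
Qed.

Lemma flow0 q : nrm (q - q0) < rho / 2 -> F (0, q) = q.
Proof.
move=> h2; apply: tends_uniq (flow_tends _ h2) _; first by rewrite nrm0.
move=> e e0; exists 0%N => k _.
case: k => [|k] /=; first by rewrite subrr nrm0 ltW.
rewrite addrC addKr; apply: le_trans (ltW e0).
apply: le_trans (@msum_bound _ _ (fun s => X (picard X k s q)) K M k 0 0 Km _ K0 K0) _.
  by move=> z Kz; apply: X_bound; apply: picard_near.
by rewrite subrr nrm0 mulr0.
Qed.

(** X is Lipschitz and the iterates converge uniformly, so the sums of X along the
iterates and along F have the same limit. *)
Lemma flow_integral t q : nrm t < T -> nrm (q - q0) < rho / 2 ->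
  tends (fun k => msum (fun s => X (F (s, q))) k 0 t) (F (t, q) - q).
Proof.
move=> h1 h2 e e0.
have e2 : 0 < e / 2 by rewrite divr_gt0.
have [N hN] := expr_half_small (L * (4 * M * T) * T) e2.
have [N' hN'] := expr_half_small (4 * M * T) e2.
exists (maxn N N') => k; rewrite geq_max => /andP[/hN k1 k2].
have {}k2 := hN' k.+1 (leqW k2).
have q1 := hF k.+1 h1 h2; rewrite /= in q1.
have q2 : nrm (msum (fun s => X (F (s, q)) - X (picard X k s q)) k 0 t) <=
   L * (4 * M * T * 2^-1 ^+ k) * T.
  apply: le_trans (@msum_bound _ _ (fun s => X (F (s, q)) - X (picard X k s q)) K (L * (4 *
      M * T * 2^-1 ^+ k)) k 0 t Km _ K0 h1) _.
    move=> z Kz; rewrite nrmBC; apply: le_trans (X_lip _ _) _.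
    - exact: picard_near.
    - by apply: near_q0 h2 (flow_near Kz h2).
    - by rewrite ler_wpM2l // hF.
  rewrite subr0; apply: ler_wpM2l; last exact: ltW h1.
  by rewrite !mulr_ge0 ?expr_half_ge0 ?(ltW T0).
rewrite msumB in q2.
have := nrm_tri (msum (fun s => X (F (s, q))) k 0 t) (msum (fun s => X (picard X k s q)) k
    0 t) (F (t, q) - q).
have -> : msum (fun s => X (picard X k s q)) k 0 t - (F (t, q) - q) =
   q + msum (fun s => X (picard X k s q)) k 0 t - F (t, q).
  by rewrite opprB addrA [q + _]addrC.
move: (2^-1 ^+ k) (2^-1 ^+ k.+1) k1 k2 q1 q2 => h h'; lra.
Qed.

(** By Goursat's theorem in the triangle 0, t, s, the increment of F between t and
s is the limit of the sums over the segment from t to s, on which X(F) is almost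
constant. *)
Lemma flow_ode t q : nrm t < T -> nrm (q - q0) < rho / 2 ->
  differentiable (fun s : C => F (s, q)) t /\
  'd (fun s : C => F (s, q)) t 1 = X (F (t, q)).
Proof.
move=> h1 h2.
pose w := X (F (t, q)).
have dg s : nrm s < T -> differentiable (fun s : C => X (F (s, q))) s.
  move=> hs; have d1 : differentiable (fun s : C => (s, q)) s.
    by apply: differentiable_pair; [exact: diff_id | exact: differentiable_cst].
  have d2 := differentiable_comp d1 (flow_diff hs h2).
  by apply: (differentiable_comp d2); apply: X_diff; apply: near_q0 h2 (flow_near hs h2).
have ll : linear (fun s : C => s *: w) by move=> a b c; rewrite scalerDl scalerA.
pose lM := GRing.isLinear.Build _ _ _ _ _ ll.
pose L' : {linear C -> V} := HB.pack (fun s : C => s *: w) lM.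
have cl : continuous L' by exact: scalel_continuous.
suff [d1 d2] : differentiable (fun s : C => F (s, q)) t /\ 'd (fun s : C => F (s, q)) t =
    L' :> (C -> V).
  by split => //; rewrite (congr1 (fun k : C -> V => k 1) d2) /L' /= scale1r.
apply: nrm_diff => // e e0.
have [d d0 hd] := (cont_nrm _ _).1 (differentiable_continuous (dg _ h1)) e e0.
exists (Num.min d ((T - nrm t) / 2)); first by rewrite lt_min d0 divr_gt0 // subr_gt0.
move=> s; rewrite lt_min => /andP[s1 s2].
pose tau := (T + nrm t) / 2.
pose D := [set z : C | nrm (z - 0) <= tau].
have DT z : D z -> nrm z < T by rewrite /D /= subr0 /tau; lra.
have Dt : D t by rewrite /D /= subr0 /tau; lra.
have Ds : D s by rewrite /D /= subr0 /tau; have := nrm_trir s t; lra.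
have D0 : D 0 by rewrite /D /= subr0 nrm0 /tau; have := nrm_ge0 t; move: T0; lra.
have Dm : mid_closed D := mid_closed_ball (c := 0) (r := tau).
have Dc : seq_closed D.
  move=> c h; rewrite /D /= subr0; apply: (@le_eps _ _ _ 1) => e' /h[z].
  by rewrite /D /= subr0 => z1 z2; have := nrm_trir c z; rewrite nrmBC; lra.
have G := goursat Dm Dc (fun z Dz => dg z (DT z Dz)) D0 Dt Ds.
have lim : tends (fun k => msum (fun s => X (F (s, q))) k t s) (F (s, q) - F (t, q)).
  move=> e' e'0; have e3 : 0 < e' / 3 by rewrite divr_gt0.
  have [N1 H1] := G _ e3.
  have [N2 H2] := flow_integral h1 h2 e3.
  have [N3 H3] := flow_integral (DT _ Ds) h2 e3.
  exists (maxn N1 (maxn N2 N3)) => k; rewrite !geq_max => /andP[/H1 g1 /andP[/H2 g2 /H3 g3]].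
  have q1 := nrmB (msum (fun s => X (F (s, q))) k 0 t - (F (t, q) - q))
     (msum (fun s => X (F (s, q))) k 0 s - (F (s, q) - q)).
  have q2 := nrmB (tri (fun s => X (F (s, q))) k 0 t s)
    ((msum (fun s => X (F (s, q))) k 0 t - (F (t, q) - q)) -
     (msum (fun s => X (F (s, q))) k 0 s - (F (s, q) - q))).
  have E : tri (fun s => X (F (s, q))) k 0 t s -
    (msum (fun s => X (F (s, q))) k 0 t - (F (t, q) - q) -
    (msum (fun s => X (F (s, q))) k 0 s - (F (s, q) - q))) =
    msum (fun s => X (F (s, q))) k t s - (F (s, q) - F (t, q)).
    rewrite /tri (msum_sym _ _ 0 s).
    move: (msum _ k 0 t) (msum _ k t s) (msum _ k 0 s) (F (s, q)) (F (t, q)) => a b c x y.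
    rewrite !opprB !addrA [LHS](ACl (2*7*6*((1*9)*(3*4)*(5*8)))) /=.
    by rewrite !subrr addNr !addr0.
  rewrite E in q2; lra.
have -> : F (s, q) - F (t, q) - L' (s - t) = F (s, q) - F (t, q) - (s - t) *: w by [].
apply: (tends_le (N := 0%N) lim) => k _.
have -> : msum (fun s => X (F (s, q))) k t s - (s - t) *: w = msum (fun s => X (F (s, q)) -
    w) k t s.
  rewrite (msumB (fun s => X (F (s, q))) (fun=> w)); congr (_ - _).
  have := msum_affine w 0 k t s; rewrite scaler0 addr0 => <-.
  by congr (msum _ _ _ _); apply/funext => z; rewrite scaler0 addr0.
apply: (@msum_bound _ _ (fun s => X (F (s, q)) - w) [set z | nrm (z - t) <= nrm (s - t)] e k t s).
- exact: mid_closed_ball.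
- by move=> z /= hz; apply: ltW; apply: hd; apply: le_lt_trans hz s1.
- by rewrite /= subrr nrm0 nrm_ge0.
- exact: lexx.
Qed.
End Limit.
End Picard.

Lemma local_flow (X : V -> V) q0 eps : complete_nrm V -> hol X q0 -> 0 < eps ->
  exists T d (F : C * V -> V), [/\ 0 < T, 0 < d &
  forall t q, nrm t < T -> nrm (q - q0) < d ->
    [/\ differentiable F (t, q), F (0, q) = q, nrm (F (t, q) - q0) < eps &
      differentiable (fun s : C => F (s, q)) t /\
      'd (fun s : C => F (s, q)) t 1 = X (F (t, q))]].
Proof.
move=> cV /hol_bounded[r [M [r0 hX]]] e0.
have M0 : 0 <= M.
  by apply: le_trans (nrm_ge0 (X q0)) (hX q0 _).2; rewrite subrr nrm0.
pose rho := Num.min (r / 2) eps; have rho0 : 0 < rho by rewrite lt_min divr_gt0.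
have rr : rho <= r / 2 by rewrite ge_min lexx.
have re : rho <= eps by rewrite ge_min lexx orbT.
pose L := 12 * M / r.
have L0 : 0 <= L by rewrite divr_ge0 ?mulr_ge0 ?(ltW r0).
pose T := Num.min (rho / 4 / (M + 1)) (1 / 4 / (L + 1)).
have T0 : 0 < T by rewrite lt_min !divr_gt0 ?ltr_wpDl.
have TM : T * M <= rho / 4.
  have : T <= rho / 4 / (M + 1) by rewrite ge_min lexx.
  by rewrite ler_pdivlMr ?ltr_wpDl //; lra.
have TL : T * L <= 1 / 4.
  have : T <= 1 / 4 / (L + 1) by rewrite ge_min lexx orbT.
  by rewrite ler_pdivlMr ?ltr_wpDl //; lra.
have Xd y : nrm (y - q0) < rho -> differentiable X y by move=> h; apply: (hX _ _).1; lra.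
have Xb y : nrm (y - q0) < rho -> nrm (X y) <= M by move=> h; apply: (hX _ _).2; lra.
have Xl y z : nrm (y - q0) < rho -> nrm (z - q0) < rho -> nrm (X y - X z) <= L * nrm (y - z).
  by move=> h h'; apply: (cauchy_lipschitz r0 hX); lra.
have [F hF] := picard_cvg Xb Xl M0 L0 T0 rho0 TM TL cV.
exists T, (rho / 2), F; split=> // [|t q ht hq]; first by rewrite divr_gt0.
split.
- exact: (flow_diff Xd Xb M0 T0 rho0 TM cV hF).
- exact: (flow0 Xb M0 T0 rho0 TM hF).
- have := flow_near Xb M0 T0 rho0 TM hF ht hq.
  by have := nrm_tri (F (t, q)) q q0; lra.
- exact: (flow_ode Xd Xb Xl M0 L0 T0 rho0 TM cV hF).
Qed.
End Flow.

(** * Open mappings and linear algebra *)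
Section OpenMapping.
Variable R : realType.
Local Notation C := (Cx R).

Lemma diff_close (E V : normedModType C) (f : E -> V) x e : hol f x -> 0 < e ->
  exists2 d : R, 0 < d & forall y h, nrm (y - x) < d -> differentiable f y /\
    nrm ('d f y h - 'd f x h) <= e * nrm h.
Proof.
move=> /hol_bounded[r [M [r0 hf]]] e0.
have M0 : 0 <= M by apply: le_trans (nrm_ge0 (f x)) (hf x _).2; rewrite subrr nrm0.
pose c := 288 * M / r ^+ 2.
have c0 : 0 <= c by apply: divr_ge0 (sqr_ge0 _); apply: (mulr_ge0 (ler0n _ 288)).
have c1 : 0 < c + 1 by rewrite ltr_wpDl.
exists (Num.min (r / 4) (e / (c + 1))); first by rewrite lt_min !divr_gt0.
move=> y h; rewrite lt_min => /andP[y1]; rewrite ltr_pdivlMr // => y2.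
split; first by apply: (hf _ _).1; lra.
apply: le_trans (cauchy_diff_lipschitz h r0 hf y1) _; rewrite -/c.
apply: ler_wpM2r; first exact: nrm_ge0.
by have := nrm_ge0 (y - x); lra.
Qed.

(** Newton's iteration z + A (y - f z), where A is a bounded right inverse of the
differential at x: near x, the distance to the target y is halved at each step. *)
Lemma open_mapping (E V : normedModType C) (f : E -> V) x (A : V -> E) (B : R) :
  complete_nrm E -> hol f x -> 0 < B ->
  (forall h, 'd f x (A h) = h) -> (forall h, nrm (A h) <= B * nrm h) ->
  forall r, 0 < r -> exists2 d : R, 0 < d & forall y, nrm (y - f x) < d ->
    exists2 z, nrm (z - x) < r & f z = y.
Proof.
move=> cE hf B0 DA nA r r0.
have e0 : 0 < (2 * B)^-1 by rewrite invr_gt0 mulr_gt0.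
have [d d0 hd] := diff_close hf e0.
pose rho := Num.min r d; have rho0 : 0 < rho by rewrite lt_min r0.
have step z h : nrm (z - x) < rho -> nrm (z + h - x) < rho ->
    nrm (f (z + h) - f z - 'd f x h) <= (2 * B)^-1 * nrm h.
  move=> h1 h2; have df := hol_diff hf.
  have -> : f (z + h) - f z - 'd f x h = f (z + h) - 'd f x (z + h) - (f z - 'd f x z).
    rewrite linearD; move: (f (z + h)) (f z) ('d f x z) ('d f x h) => a b p q /=.
    by rewrite opprB opprD !addrA [RHS](ACl (1*5*3*(2*4))) /= addNr addr0.
  apply: (@mvt_line _ _ _ (fun y => f y - 'd f x y)) => t ht.
  have ht' : nrm (z + t *: h - x) < rho.
    by have := ball_segment h2 h1 ht; rewrite [z + h - z]addrC addKr.
  move: ht'; rewrite lt_min => /andP[_ ht'].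
  have [dt q] := hd _ h ht'.
  have [d1 d2] := diff_lin_id (z + t *: h) (diff_continuous df).
  have [e1 e2] := diff_sub dt d1; split => //.
  by rewrite (etrans (e2 h) (congr1 (fun k : E -> V => 'd f (z + t *: h) h - k h) d2)).
exists (rho / (2 * B)); first by rewrite divr_gt0 // mulr_gt0.
move=> y; rewrite ltr_pdivlMr ?mulr_gt0 // => hy.
pose D := nrm (y - f x); have D0 : 0 <= D := nrm_ge0 _.
pose u := fix u k := if k is k'.+1 then u k' + A (y - f (u k')) else x.
have U k : nrm (u k - x) <= 2 * B * D * (1 - 2^-1 ^+ k) /\ nrm (y - f (u k)) <= D * 2^-1 ^+ k.
  elim: k => [|k [h1 h2]]; first by rewrite /= !expr0 subrr nrm0 subrr mulr0 mulr1.
  have hp := expr_half_ge0 R k; have hl := expr_half_le1 R k.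
  have BD : 0 <= B * D by rewrite mulr_ge0 // ltW.
  have BDh : 0 <= B * D * 2^-1 ^+ k by rewrite mulr_ge0.
  have n1 := nA (y - f (u k)).
  have n2 : nrm (A (y - f (u k))) <= B * D * 2^-1 ^+ k.
    by apply: le_trans n1 _; rewrite -mulrA ler_wpM2l // ltW.
  have n3 : nrm (u k.+1 - x) <= 2 * B * D * (1 - 2^-1 ^+ k.+1).
    rewrite /= addrAC; apply: le_trans (nrmD _ _) _; rewrite exprS.
    by move: (2^-1 ^+ k) n2 h1 => h; lra.
  split => //.
  have i1 : nrm (u k - x) < rho by rewrite /D in h1 BD BDh; move: (2^-1 ^+ k) BDh h1 => h; lra.
  have i2 : nrm (u k + A (y - f (u k)) - x) < rho.
    apply: le_lt_trans n3 _; have := expr_half_ge0 R k.+1; move: (2^-1 ^+ k.+1) => h h0.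
    have := mulr_ge0 BD h0; move: hy; rewrite -/D; lra.
  have := step _ _ i1 i2; rewrite DA opprB addrA subrK nrmBC.
  move=> /le_trans; apply.
  have := ler_wpM2l (ltW e0) n2; rewrite exprS => /le_trans; apply.
  by rewrite le_eqVlt; apply/orP; left; apply/eqP; field; rewrite gt_eqF.
have [|z hz] := @geo_lim _ _ u (B * D) cE.
  move=> k; rewrite /= addrC addKr; apply: le_trans (nA _) _.
  by rewrite -mulrA ler_wpM2l ?(ltW B0) //; exact: (U k).2.
have zx : nrm (z - x) < rho.
  have := hz 0%N; rewrite expr0 /= nrmBC => h; apply: le_lt_trans h _.
  by move: hy; rewrite -/D; lra.
move: (zx); rewrite lt_min => /andP[zr zd].
exists z => //.
have fc := differentiable_continuous (hd z 0 zd).1.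
have t1 : tends (fun k => f (u k)) (f z).
  move=> e /((cont_nrm f z).1 fc)[d' d'0 hd'].
  have [N hN] := expr_half_small (2 * (B * D)) (divr_gt0 d'0 (ltr0Sn _ 1)).
  exists N => k /hN hk; apply: ltW; apply: hd'; apply: le_lt_trans (hz k) _; lra.
apply: tends_uniq t1 _ => e /(expr_half_small D)[N hN].
by exists N => k /hN; apply: le_trans; rewrite nrmBC; exact: (U k).2.
Qed.

Lemma row_linear_bound n (V : normedModType C) (L : {linear 'rV[C]_n -> V}) :
  exists2 B : R, 0 < B & forall x, nrm (L x) <= B * nrm x.
Proof.
exists (\sum_(i < n) nrm (L (delta_mx 0 i)) + 1).
  by rewrite ltr_wpDl // sumr_ge0 // => *; exact: nrm_ge0.
move=> x; rewrite [X in L X]row_sum_delta linear_sum.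
apply: le_trans (nrm_sum _ _ _) _; rewrite mulrDl mul1r mulr_suml ler_wpDr ?nrm_ge0 //.
apply: ler_sum => i _; rewrite linearZ nrmZ mulrC ler_wpM2l ?nrm_ge0 //.
exact: nrm_coord.
Qed.

Lemma row_linear_continuous n (V : normedModType C) (L : {linear 'rV[C]_n -> V}) : continuous L.
Proof. by have [B _ h] := row_linear_bound L; exact: bound_continuous h. Qed.

End OpenMapping.

Section LinearAlgebra.
Variable R : realType.
Local Notation C := (Cx R).

Lemma injective_dim k n (L : {linear 'rV[C]_k -> 'rV[C]_n}) :
  (forall v, L v = 0 -> v = 0) -> (k <= n)%N.
Proof.
move=> inj; have : row_free (lin1_mx L).
  rewrite -kermx_eq0; apply/eqP/row_matrixP => i; rewrite row0.
  apply: inj; rewrite -(mul_rV_lin1 L) -row_mul mulmx_ker row0 //.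
by rewrite /row_free => /eqP <-; exact: rank_leq_col.
Qed.

Lemma injective_bound k n (L : {linear 'rV[C]_k -> 'rV[C]_n}) :
  (forall v, L v = 0 -> v = 0) -> exists2 B : R, 0 < B & forall v, nrm v <= B * nrm (L v).
Proof.
move=> inj; have rf : row_free (lin1_mx L).
  rewrite -kermx_eq0; apply/eqP/row_matrixP => i; rewrite row0.
  apply: inj; rewrite -(mul_rV_lin1 L) -row_mul mulmx_ker row0 //.
have [B B0 hB] := row_linear_bound (mulmxr (pinvmx (lin1_mx L)) : {linear 'rV[C]_n -> 'rV[C]_k}).
exists B => // v; apply: le_trans (hB (L v)); rewrite /= -(mul_rV_lin1 L) mulmxKp //.
Qed.

Lemma surjective_section k n (L : {linear 'rV[C]_k -> 'rV[C]_n}) :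
  (forall w, exists v, L v = w) ->
  exists (A : 'rV[C]_n -> 'rV[C]_k) (B : R), [/\ 0 < B, forall w, L (A w) = w &
    forall w, nrm (A w) <= B * nrm w].
Proof.
move=> surj.
have [B B0 hB] := row_linear_bound (mulmxr (pinvmx (lin1_mx L)) : {linear 'rV[C]_n -> 'rV[C]_k}).
exists (mulmxr (pinvmx (lin1_mx L))), B; split=> // w.
rewrite -(mul_rV_lin1 L) /= mulmxKpV //; have [v <-] := surj w.
by rewrite -(mul_rV_lin1 L) submxMl.
Qed.

(** Membership in the range of L becomes an equation, which can be differentiated. *)
Lemma range_annihilator k n (L : {linear 'rV[C]_k -> 'rV[C]_n}) :
  exists l : {linear 'rV[C]_n -> 'rV[C]_n}, (forall v, l (L v) = 0) /\
    forall w, l w = 0 -> exists v, L v = w.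
Proof.
exists (mulmxr (cokermx (lin1_mx L))); split => [v|w].
  by rewrite /= -(mul_rV_lin1 L) -mulmxA mulmx_coker mulmx0.
rewrite /= => /eqP; rewrite -submxE => /submxP[v ->]; exists v.
by rewrite mul_rV_lin1.
Qed.

End LinearAlgebra.

(** * Fields tangent to an immersed image *)
Section Involutive.
Variable R : realType.
Local Notation C := (Cx R).

Lemma diff_apply_comp (E V W : normedModType C) (f : E -> V) (L : {linear V -> W}) x :
  continuous L -> differentiable f x ->
  differentiable (fun y => L (f y)) x /\ forall h, 'd (fun y => L (f y)) x h = L ('d f x h).
Proof.
move=> cL df; have [d1 d2] := diff_lin_id (f x) cL.
split; first exact: (differentiable_comp df d1).
move=> h; apply: etrans (congr1 (fun k : E -> W => k h) (diff_comp df d1)) _.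
exact: (congr1 (fun k : V -> W => k ('d f x h)) d2).
Qed.

(** Write Y (Th s') = dTh_s' (y s') near s and let l vanish on the range of dTh_s.
Then l (Y (Th s') - dTh_s' y0) = l ((dTh_s' - dTh_s) (y s' - y0)) is o(s' - s), as
dTh is Lipschitz and the lower bound on dTh makes y continuous at s. So its
derivative at s is 0, which is the assertion. *)
Lemma tangent_derivative (E V W : normedModType C) (Th : E -> V) (Y : V -> V)
    (l : {linear V -> W}) (c r : R) s y0 z : complete_nrm V ->
  hol Th s -> differentiable Y (Th s) -> continuous l -> 0 < r ->
  (forall s' v, nrm (s' - s) < r -> nrm v <= c * nrm ('d Th s' v)) ->
  (forall s', nrm (s' - s) < r -> exists y, 'd Th s' y = Y (Th s')) ->
  (forall v, l ('d Th s v) = 0) -> 'd Th s y0 = Y (Th s) ->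
  l ('d Y (Th s) ('d Th s z)) = l ('d (fun s' => 'd Th s' y0) s z).
Proof.
move=> cV hT dY cl r0 hc hY hl hy0.
have dT := hol_diff hT; have dD := diff_dir y0 cV hT.
have dYT := differentiable_comp dT dY.
have [d1 e1] := diff_sub dYT dD.
have [d2 e2] := diff_apply_comp cl d1.
pose w s' := (Y \o Th) s' - 'd Th s' y0.
have w0 : w s = 0 by rewrite /w /= hy0 subrr.
have [B B0 hB] := linear_bound cl.
have c0 : 0 <= c \/ forall v : E, nrm v = 0.
  case: (leP 0 c) => hcc; [by left | right => v].
  apply/eqP; rewrite eq_le nrm_ge0 andbT.
  have := hc s v; rewrite subrr nrm0 => /(_ r0) /le_trans; apply.
  by rewrite nmulr_rle0 // nrm_ge0.
have [M [rho [rho0 M0 hM]]] : exists M rho : R, [/\ 0 < rho, 0 <= M &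
   forall s' v, nrm (s' - s) < rho -> nrm ('d Th s' v - 'd Th s v) <= M * nrm (s' - s) * nrm v].
  have [rr [M [rr0 hf]]] := hol_bounded hT.
  have M0 : 0 <= M by apply: le_trans (nrm_ge0 (Th s)) (hf s _).2; rewrite subrr nrm0.
  exists (288 * M / rr ^+ 2), (rr / 4); split; first by rewrite divr_gt0.
    by apply: divr_ge0 (sqr_ge0 _); apply: (mulr_ge0 (ler0n _ 288)).
  by move=> s' v; exact: cauchy_diff_lipschitz.
have [_ D0] : differentiable (fun y => l (w y)) s /\ 'd (fun y => l (w y)) s = (\0 :
    {linear E -> W}) :> (E -> W).
  apply: nrm_diff; first by move=> x; exact: cst_continuous.
  move=> e e0; pose e' := e / (B * M * `|c| + 1).
  have k0 : 0 < B * M * `|c| + 1 by rewrite ltr_wpDl // !mulr_ge0 // ltW.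
  have e'0 : 0 < e' by rewrite divr_gt0.
  have [d d0 hd] := (cont_nrm w s).1 (differentiable_continuous d1) _ e'0.
  exists (Num.min (Num.min d r) rho); first by rewrite !lt_min d0 r0.
  move=> s'; rewrite !lt_min => /andP[/andP[s1 s2] s3].
  rewrite w0 linear0 subr0 subr0.
  have [y hy] := hY _ s2.
  have wE : w s' = 'd Th s' (y - y0) by rewrite linearB hy.
  have -> : l (w s') = l ('d Th s' (y - y0) - 'd Th s (y - y0)).
    by rewrite (linearB l ('d Th s' (y - y0)) ('d Th s (y - y0))) hl subr0 wE.
  apply: le_trans (hB _) _.
  have hyy : nrm (y - y0) <= `|c| * e'.
    apply: le_trans (hc _ _ s2) _; rewrite -wE.
    have := hd _ s1; rewrite w0 subr0 => /ltW h.
    apply: le_trans (ler_wpM2l (normr_ge0 c) h).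
    by rewrite ler_wpM2r ?nrm_ge0 // ler_norm.
  have n0 := nrm_ge0 (s' - s).
  apply: le_trans (ler_wpM2l (ltW B0) (hM _ _ s3)) _.
  have Mn : 0 <= M * nrm (s' - s) by rewrite mulr_ge0.
  apply: le_trans (ler_wpM2l (ltW B0) (ler_wpM2l Mn hyy)) _.
  have -> : B * (M * nrm (s' - s) * (`|c| * e')) = (B * M * `|c|) * e' * nrm (s' - s) by ring.
  apply: ler_wpM2r => //; rewrite /e' mulrA ler_pdivrMr // mulrDr mulr1 [e * _]mulrC lerDl ltW //.
have D0z := congr1 (fun k : E -> W => k z) D0.
have D0z' := etrans (esym (e2 z)) D0z.
have e3 := etrans (e1 z) (congr1 (fun k : E -> V => k z - 'd (fun s' => 'd Th s' y0) s z)
    (diff_comp dT dY)).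
have := etrans (congr1 l (esym e3)) D0z'.
rewrite (linearB l) => /subr0_eq; exact.
Qed.

Lemma hol_sub (E V : normedModType C) (f g : E -> V) x : hol f x -> hol g x ->
  hol (fun y => f y - g y) x.
Proof.
move=> [r r0 hf] [r' r'0 hg]; exists (Num.min r r'); first by rewrite lt_min r0.
by move=> y; rewrite lt_min => /andP[/hf ? /hg ?]; apply: (diff_sub _ _).1.
Qed.

(** Expansion of g y in the standard basis reduces this to derivatives along fixed
vectors. *)
Lemma hol_apply n (V : normedModType C) (f : 'rV[C]_n -> V) (g : 'rV[C]_n -> 'rV[C]_n) x :
  complete_nrm V -> hol f x -> hol g x -> hol (fun y => 'd f y (g y)) x.
Proof.
move=> cV hf hg.
have [r r0 hr] := hol_near hf; have [r' r'0 hr'] := hg.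
exists (Num.min r r'); first by rewrite lt_min r0.
move=> y; rewrite lt_min => /andP[/hr hy /hr' gy].
have -> : (fun y => 'd f y (g y)) = \sum_(i < n) (fun y => g y 0 i *: 'd f y (delta_mx 0 i)).
  apply/funext => z; rewrite fct_sumE [X in 'd f z X]row_sum_delta linear_sum.
  by apply: eq_bigr => i _; rewrite linearZ.
apply: differentiable_sum => i; apply: differentiable_scale; last exact: diff_dir.
exact: (differentiable_comp gy (differentiable_coord (g y) 0 i)).
Qed.

End Involutive.

(** * The theorem of Chow and Rashevskii in a chart *)
Section LocalChow.
Variables (R : realType) (n d : nat).
Local Notation C := (Cx R).
Local Notation W := 'rV[Cx R]_n.

Inductive bracket_field (X : 'I_d -> W -> W) : (W -> W) -> Prop :=
| bracket_field_gen j : bracket_field X (X j)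
| bracket_field_lie Y Z : bracket_field X Y -> bracket_field X Z ->
    bracket_field X (fun z => 'd Z z (Y z) - 'd Y z (Z z)).

Definition open_nrm (O : set W) := forall x, O x ->
  exists2 r : R, 0 < r & forall y, nrm (y - x) < r -> O y.

(* [conn] stands for being joined by a chain of tangential discs; all that matters
   is that it is an equivalence relation which contains the integral curves. *)
Variables (O : set W) (X : 'I_d -> W -> W) (conn : W -> W -> Prop).
Hypothesis O_open : open_nrm O.
Hypothesis X_hol : forall j x, O x -> hol (X j) x.
Hypothesis conn_refl : forall x, conn x x.
Hypothesis conn_sym : forall x y, conn x y -> conn y x.
Hypothesis conn_trans : forall x y z, conn x y -> conn y z -> conn x z.
Hypothesis conn_curve : forall j (g : C -> W) (T : R),
  (forall t, nrm t < T -> [/\ O (g t), differentiable g t & 'd g t 1 = X j (g t)]) ->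
  forall t, nrm t < T -> conn (g 0) (g t).
Hypothesis spanning : forall x (w : W), O x -> lspan [set Y x | Y in bracket_field X] w.

Lemma bracket_field_hol Y x : bracket_field X Y -> O x -> hol Y x.
Proof.
move=> hY; elim: hY x => [j|{}Y Z _ IHY _ IHZ] x Ox; first exact: X_hol.
have cW := @complete_row R n.
apply: hol_sub; apply: hol_apply => //; auto.
Qed.

Variable p : W.
Hypothesis Op : O p.

(** Besides being joined to p, a reachable point comes with a way of moving all
points near p continuously to points near q, within their classes. *)
Definition reachable (q : W) := O q /\ exists G : W -> W,
  [/\ {for p, continuous G}, G p = q &
   exists2 r : R, 0 < r & forall y, nrm (y - p) < r -> conn (G y) y].

Lemma reachable_conn q : reachable q -> conn q p.
Proof.
move=> [_ [G [_ <- [r r0 h]]]]; apply: h; by rewrite subrr nrm0.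
Qed.

Lemma reachable_center : reachable p.
Proof. by split => //; exists id; split => //; exists 1. Qed.

(** The flow of X_j is composed with the map that moves p to q. *)
Lemma reachable_flow j q0 : O q0 -> exists T r (F : C * W -> W), [/\ 0 < T, 0 < r &
  forall t q, nrm t < T -> nrm (q - q0) < r ->
    [/\ differentiable F (t, q), F (0, q) = q, (reachable q -> reachable (F (t, q))) &
      differentiable (fun s : C => F (s, q)) t /\
      'd (fun s : C => F (s, q)) t 1 = X j (F (t, q))]].
Proof.
move=> Oq; have [e e0 he] := O_open Oq.
have [T [r [F [T0 r0 hF]]]] := local_flow (@complete_row R n) (X_hol j Oq) e0.
exists T, r, F; split => // t q ht hq; have [h1 h2 h3 h4] := hF t q ht hq.
split => // -[Oq' [G [cG Gp [s s0 hs]]]]; split; first exact: he.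
exists (fun y => F (t, G y)); split; last first.
- have [s' s'0 hs'] := (cont_nrm G p).1 cG (r - nrm (q - q0)) ltac:(rewrite subr_gt0; exact: hq).
  exists (Num.min s s'); first by rewrite lt_min s0.
  move=> y; rewrite lt_min => /andP[/hs y1 /hs' y2].
  apply: conn_trans y1; apply: conn_sym.
  have hG : nrm (G y - q0) < r.
    rewrite Gp in y2; apply: le_lt_trans (nrm_tri _ q _) _.
    by rewrite -ltrBrDr.
  have [_ F0 _ _] := hF t _ ht hG.
  rewrite -{1}F0; apply: (@conn_curve j (fun s => F (s, G y)) T _ t ht) => u hu.
  by have [k1 k2 k3 [k4 k5]] := hF u _ hu hG; split => //; exact: he.
- by rewrite Gp.
- have c1 : {for (t, G p), continuous F}.
    by apply: differentiable_continuous; rewrite Gp.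
  apply/cont_nrm => a a0; have [b b0 hb] := (cont_nrm F _).1 c1 a a0.
  have [b' b'0 hb'] := (cont_nrm G p).1 cG b b0; exists b' => // y /hb' hy.
  by apply: hb; rewrite nrm_pair /= subrr nrm0 gt_max b0.
Qed.

Definition immersed (k : nat) (Th : 'rV[C]_k -> W) (t : 'rV[C]_k) :=
  (exists2 r : R, 0 < r & forall s, nrm (s - t) < r -> differentiable Th s /\ reachable (Th s)) /\
  forall v, 'd Th t v = 0 -> v = 0.

Definition attained (k : nat) := exists Th t, @immersed k Th t.

Lemma attained0 : attained 0.
Proof.
exists (fun _ : 'rV[C]_0 => p), 0; split; last by move=> v _; rewrite thinmx0.
exists 1 => // s _; split; [exact: differentiable_cst | exact: reachable_center].
Qed.

Lemma attained_le k : attained k -> (k <= n)%N.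
Proof. by move=> [Th [t [_ h]]]; exact: injective_dim h. Qed.

(** At time 0 the flow is the identity in q and has velocity X_j. *)
Lemma flow_differential j (F : C * W -> W) q (T r : R) : 0 < T -> 0 < r ->
  differentiable F (0, q) -> (forall y, nrm (y - q) < r -> F (0, y) = y) ->
  'd (fun s : C => F (s, q)) 0 1 = X j q ->
  forall s w, 'd F (0, q) (s, w) = s *: X j q + w.
Proof.
move=> T0 r0 dF F0 Fq s w.
have E1 : 'd F (0, q) (@pair C W 1 0) = X j q.
  have := (@diff_line _ _ _ F (0, q) (@pair C W 1 0) 0); rewrite scale0r addr0 => /(_ dF)[_ <-].
  have -> : (fun s : C => F ((0, q) + s *: (@pair C W 1 0))) = (fun s : C => F (s, q)).
    apply/funext => u; congr (F _); apply/eqP.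
    by rewrite xpair_eqE /= scaler0 addr0 add0r [_ *: _]mulr1 !eqxx.
  exact: Fq.
have E2 : 'd F (0, q) (@pair C W 0 w) = w.
  have := (@diff_line _ _ _ F (0, q) (@pair C W 0 w) 0); rewrite scale0r addr0 => /(_ dF)[_ <-].
  have w1 : 0 < nrm w + 1 by rewrite ltr_wpDl // nrm_ge0.
  have ll : linear (fun s : C => s *: w) by move=> a b c; rewrite scalerDl scalerA.
  pose lM := GRing.isLinear.Build _ _ _ _ _ ll.
  pose L' : {linear C -> W} := HB.pack (fun s : C => s *: w) lM.
  have cl : continuous L' by exact: scalel_continuous.
  suff [_ d2] : differentiable (fun s : C => F ((0, q) + s *: (@pair C W 0 w))) 0 /\
      'd (fun s : C => F ((0, q) + s *: (@pair C W 0 w))) 0 = L' :> (C -> W).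
    by rewrite (congr1 (fun k : C -> W => k 1) d2) /L' /= scale1r.
  have H (u : C) : nrm u < r / (nrm w + 1) -> F ((0, q) + u *: (@pair C W 0 w)) = q + u *: w.
    rewrite ltr_pdivlMr // => hu.
    have -> : (0, q) + u *: (@pair C W 0 w) = (0 + u *: 0, q + u *: w) :> C * W by [].
    rewrite scaler0 addr0 F0 // addrC addKr nrmZ.
    by have := nrm_ge0 u; lra.
  apply: nrm_diff => // e e0; exists (r / (nrm w + 1)); first by rewrite divr_gt0.
  move=> u; rewrite subr0 => hu; rewrite !H //; last by rewrite nrm0 divr_gt0.
  rewrite scale0r addr0 [q + _]addrC addrK /L' /= subrr nrm0.
  by rewrite mulr_ge0 ?nrm_ge0 // ltW.
have -> : (s, w) = s *: (@pair C W 1 0) + (@pair C W 0 w) :> C * W.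
  by apply/eqP; rewrite xpair_eqE /= scaler0 addr0 add0r [_ *: _]mulr1 !eqxx.
rewrite linearD E2; congr (_ + _).
by apply: etrans (linearZ _ _) _; rewrite E1.
Qed.

(** The map u |-> F (u_k+1, Th (u_1, .., u_k)), where F is the flow of X_j, has the
differential (dv, c) |-> dTh dv + c X_j (Th t), which is injective when X_j (Th t)
is not in the range of dTh. *)
Lemma attained_extend k Th t j : @immersed k Th t ->
  ~ (exists v, 'd Th t v = X j (Th t)) -> attained (k + 1).
Proof.
move=> [[r r0 hr] inj] nX.
have [dT At] : differentiable Th t /\ reachable (Th t) by apply: hr; rewrite subrr nrm0.
have [T [r' [F [T0 r'0 hF]]]] := reachable_flow j At.1.
have [d1 d10 hd] := (cont_nrm Th t).1 (differentiable_continuous dT) _ r'0.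
pose E := 'rV[C]_(k + 1).
have lc : continuous (lsubmx : E -> 'rV[C]_k) by exact: row_linear_continuous.
have rc : continuous (fun u : E => rsubmx u 0 0).
  move=> u; apply: differentiable_continuous.
  exact: (differentiable_comp (differentiable_rsubmx u) (differentiable_coord (rsubmx u) 0 0)).
pose H (u : E) : W := F (rsubmx u 0 0, Th (lsubmx u)).
exists H, (row_mx t 0).
have dH u : nrm (rsubmx u 0 0) < T -> nrm (lsubmx u - t) < Num.min r d1 ->
   differentiable H u /\ reachable (H u).
  rewrite lt_min => h1 /andP[h2 h3].
  have [k1 k2] := hr _ h2; have [f1 f2 f3 f4] := hF _ _ h1 (hd _ h3).
  split; last exact: f3.
  have a1 : differentiable (fun u : E => rsubmx u 0 0) u.
    exact: (differentiable_comp (differentiable_rsubmx u) (differentiable_coord (rsubmx u) 0 0)).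
  have a2 := differentiable_comp (differentiable_lsubmx u) k1.
  exact: (differentiable_comp (differentiable_pair a1 a2) f1).
have m0 : 0 < Num.min r d1 by rewrite lt_min r0.
split.
  have [e1 e10 he1] := (cont_nrm _ (row_mx t 0)).1 (@rc _) _ T0.
  have [e2 e20 he2] := (cont_nrm _ (row_mx t 0)).1 (@lc _) _ m0.
  exists (Num.min e1 e2); first by rewrite lt_min e10.
  move=> u; rewrite lt_min => /andP[/he1 u1 /he2 u2]; apply: dH.
    by move: u1; rewrite row_mxKr [X in _ - X]mxE subr0.
  by move: u2; rewrite row_mxKl.
move=> v hv.
have t0 : rsubmx (row_mx t (0 : 'rV[C]_1)) 0 0 = 0 by rewrite row_mxKr mxE.
have t1 : lsubmx (row_mx t (0 : 'rV[C]_1)) = t by rewrite row_mxKl.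
have q0 : nrm (Th t - Th t) < r' by rewrite subrr nrm0.
have n00 : nrm (0 : C) < T by rewrite nrm0.
have [f1 f2 _ [f3 f4]] := hF 0 _ n00 q0.
have [l1 l1E] : exists L : {linear E -> C}, L =1 (fun u : E => rsubmx u 0 0).
  by apply: linear_of => [x y|a x]; rewrite !mxE.
have l1F : (fun u : E => rsubmx u 0 0) = l1 by apply/funext => u; rewrite l1E.
have c1 : continuous l1 by rewrite -l1F.
have [a1 b1] := diff_lin_id (row_mx t 0) c1.
have [a2 b2] := diff_lin_id (row_mx t 0 : E) lc.
have dT' : differentiable Th (lsubmx (row_mx t 0 : E)) by rewrite t1.
have a3 := differentiable_comp a2 dT'.
have b3 : 'd (Th \o lsubmx) (row_mx t 0 : E) v = 'd Th t (lsubmx v).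
  apply: etrans (congr1 (fun k : E -> W => k v) (diff_comp a2 dT')) _.
  rewrite /= -[in RHS]t1; congr ('d Th _ _).
  exact: (congr1 (fun k : E -> 'rV[C]_k => k v) b2).
have dP := differentiable_pair a1 a3.
have P0 : (l1 (row_mx t 0), (Th \o lsubmx) (row_mx t 0 : E)) = (0, Th t).
  by rewrite l1E t0 /= t1.
have dF' : differentiable F (l1 (row_mx t 0), (Th \o lsubmx) (row_mx t 0 : E)) by rewrite P0.
have HE : H = F \o (fun u : E => (l1 u, (Th \o lsubmx) u)).
  by apply/funext => u; rewrite /H /= l1E.
have dFE (P : C * W) a b : P = (0, Th t) -> 'd F P (a, b) = a *: X j (Th t) + b.
  have F0' y : nrm (y - Th t) < r' -> F (0, y) = y.
    by move=> hy; have [_ -> _ _] := hF 0 _ n00 hy.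
  move=> ->; exact: (flow_differential T0 r'0 f1 F0' (etrans f4 (congr1 (X j) f2))).
have key : 'd H (row_mx t 0) v = l1 v *: X j (Th t) + 'd Th t (lsubmx v).
  rewrite HE; apply: etrans (congr1 (fun k : E -> W => k v) (diff_comp dP dF')) _.
  have e1 : 'd (fun u : E => (l1 u, (Th \o lsubmx) u)) (row_mx t 0) v =
     (l1 v, 'd Th t (lsubmx v)).
    apply: etrans (congr1 (fun k : E -> C * W => k v) (diff_pair a1 a3)) _.
    by rewrite /= b3; congr (_, _); exact: (congr1 (fun k : E -> C => k v) b1).
  apply: etrans (congr1 ('d F (l1 (row_mx t 0), (Th \o lsubmx) (row_mx t 0 : E))) e1) _.
  exact: dFE P0.
move: hv; rewrite key => hv.
have v1 : l1 v = 0.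
  apply: contrapT => /eqP nz; apply: nX; exists (- (l1 v)^-1 *: lsubmx v).
  apply: etrans (linearZ _ _) _.
  have -> : 'd Th t (lsubmx v) = - (l1 v *: X j (Th t)).
    by apply/eqP; rewrite -addr_eq0 addrC hv.
  by rewrite /= scalerN scaleNr opprK scalerA mulVf // scale1r.
move: hv; rewrite v1 scale0r add0r => /inj v2.
rewrite -[v]hsubmxK v2.
have -> : rsubmx v = 0.
  by apply/matrixP => a b; rewrite !ord1; have := v1; rewrite l1E => ->; rewrite mxE.
exact: row_mx0.
Qed.

Lemma maximal_rank : exists k, attained k /\ ~ attained (k + 1).
Proof.
apply: contrapT => /forallNP h.
have H k : attained k.
  elim: k => [|k IH]; first exact: attained0.
  by apply: contrapT => nk; apply: (h k); rewrite addn1.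
by have := attained_le (H n.+1); rewrite ltnn.
Qed.

Lemma half_bound (a b u B : R) : 0 < B -> u <= B * a -> a <= b + (2 * B)^-1 * u ->
  u <= 2 * B * b.
Proof.
move=> B0 h2 h3; have h4 := le_trans h2 (ler_wpM2l (ltW B0) h3).
have h5 : B * (b + (2 * B)^-1 * u) = B * b + u / 2 by field; rewrite gt_eqF.
by rewrite h5 in h4; lra.
Qed.

(** Injectivity is an open condition, in the quantitative form of a lower bound. *)
Lemma immersed_near k Th t : @immersed k Th t -> exists c r : R, 0 < r /\
  forall s, nrm (s - t) < r -> [/\ hol Th s, reachable (Th s) &
    forall v, nrm v <= c * nrm ('d Th s v)].
Proof.
move=> [[r r0 hr] inj].
have hT : hol Th t by exists r => // s /hr[].
have [B B0 hB] := injective_bound inj.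
have e0 : 0 < (2 * B)^-1 by rewrite invr_gt0 mulr_gt0.
have [d0 d00 hd] := diff_close hT e0.
have [r1 r10 hr1] := hol_near hT.
exists (2 * B), (Num.min (Num.min r r1) d0); split; first by rewrite !lt_min r0 r10.
move=> s; rewrite !lt_min => /andP[/andP[/hr[_ s1] /hr1 s2] s3].
split; [exact: s2 | exact: s1 | move=> v].
have [_ h1] := hd s v s3; have h2 := hB v.
have h3 : nrm ('d Th t v) <= nrm ('d Th s v) + (2 * B)^-1 * nrm v.
  apply: le_trans (nrm_trir _ ('d Th s v)) _.
  by apply: lerD (lexx _) _; apply: le_eq_trans (nrmBC _ _) h1.
exact: half_bound B0 h2 h3.
Qed.

(** For the generators this is the maximality of k. For a bracket, with
Y (Th s) = dTh_s y and Z (Th s) = dTh_s z, [tangent_derivative] turns the two terms of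
the bracket into second derivatives of Th along (y, z) and (z, y), modulo the
range of dTh_s. *)
Lemma bracket_tangent k Th t c r Y : ~ attained (k + 1) -> 0 < r ->
  (forall s : 'rV[C]_k, nrm (s - t) < r -> [/\ hol Th s, reachable (Th s) &
    forall v, nrm v <= c * nrm ('d Th s v)]) ->
  bracket_field X Y -> forall s, nrm (s - t) < r -> exists v, 'd Th s v = Y (Th s).
Proof.
move=> nk r0 hT; have cW := @complete_row R n.
elim => [j|{}Y Z BY IHY BZ IHZ] s hs.
  apply: contrapT => nj; apply: nk; apply: (@attained_extend k Th s j) => //.
  split; last first.
    move=> v hv; apply: nrm_eq0; apply/eqP; rewrite eq_le nrm_ge0 andbT.
    by have [_ _ /(_ v)] := hT s hs; rewrite hv nrm0 mulr0.
  exists (r - nrm (s - t)); first by rewrite subr_gt0.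
  move=> s' hs'; have [|h1 h2 _] := hT s'.
    apply: le_lt_trans (nrm_tri _ s _) _; by rewrite -ltrBrDr.
  by split => //; exact: hol_diff.
have [h1 h2 h3] := hT s hs; have [Os _] := h2.
have [y hy] := IHY s hs; have [z hz] := IHZ s hs.
have [l [l0 lr]] := range_annihilator ('d Th s).
apply: lr; apply: etrans (linearB l _ _) _.
have r1 : 0 < r - nrm (s - t) by rewrite subr_gt0.
have near s' : nrm (s' - s) < r - nrm (s - t) -> nrm (s' - t) < r.
  by move=> h; apply: le_lt_trans (nrm_tri _ s _) _; rewrite -ltrBrDr.
have lb s' v : nrm (s' - s) < r - nrm (s - t) -> nrm v <= c * nrm ('d Th s' v).
  by move=> /near hs'; have [_ _] := hT s' hs'; apply.
have ty s' (h : nrm (s' - s) < r - nrm (s - t)) := IHY s' (near s' h).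
have tz s' (h : nrm (s' - s) < r - nrm (s - t)) := IHZ s' (near s' h).
have lc : continuous l by exact: row_linear_continuous.
have e1 := tangent_derivative z cW h1 (hol_diff (bracket_field_hol BY Os)) lc r1 lb ty l0 hy.
have e2 := tangent_derivative y cW h1 (hol_diff (bracket_field_hol BZ Os)) lc r1 lb tz l0 hz.
have e1' := etrans (congr1 (fun w => l ('d Y (Th s) w)) (esym hz)) e1.
have e2' := etrans (congr1 (fun w => l ('d Z (Th s) w)) (esym hy)) e2.
have e3 := congr1 l (diff_sym y z cW h1).
have e4 := etrans e2' (etrans e3 (esym e1')).
exact: (etrans (congr1 (fun u => u - _) e4) (subrr _)).
Qed.

Lemma local_chow : exists2 r : R, 0 < r & forall y, nrm (y - p) < r -> conn y p.
Proof.
have cW := @complete_row R.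
have [k [[Th [t im]] nk]] := maximal_rank.
have [c [r [r0 hr]]] := immersed_near im.
have tt : nrm (t - t) < r by rewrite subrr nrm0.
have [h1 h2 _] := hr _ tt.
have surj w : exists v, 'd Th t v = w.
  have [m [a [u [hu ->]]]] := @spanning _ w h2.1.
  elim: m a u hu => [|m IH] a u hu.
    by exists 0; rewrite linear0 big_ord0.
  rewrite big_ord_recl; have [v1 e1] := IH (fun j => a (lift ord0 j)) (fun j => u (lift
      ord0 j)) (fun j => hu (lift ord0 j)).
  have [Y BY uY] := hu ord0.
  have [v2 e2] := bracket_tangent nk r0 hr BY tt.
  exists (a ord0 *: v2 + v1); rewrite linearD e1 -uY -e2.
  by congr (_ + _); exact: linearZ.
have [A [B [B0 hA nA]]] := surjective_section surj.
have [d0 d00 hd] := open_mapping (cW k) h1 B0 hA nA r0.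
have near y : nrm (y - Th t) < d0 -> reachable y.
  by move=> /hd[z /hr[_ hz _] <-].
have [_ [G [cG Gp [s s0 hs]]]] := h2.
have [s' s'0 hs'] := (cont_nrm G p).1 cG _ d00.
exists (Num.min s s'); first by rewrite lt_min s0.
move=> y; rewrite lt_min => /andP[/hs y1 /hs' y2].
rewrite Gp in y2; have y3 := reachable_conn (near _ y2).
by apply: conn_trans y3; exact: conn_sym.
Qed.

End LocalChow.

(** * Chains of tangential discs *)
Section Manifold.
Variables (R : realType) (n : nat) (M : complexManifold R n) (D : holoDistribution M).
Local Notation C := (Cx R).
Local Notation W := 'rV[Cx R]_n.
Local Notation dom i := (chart_dom (atlas (c := M) i)).
Local Notation phi i := (atlas (c := M) i).
Local Notation psi i := (chart_inv (atlas (c := M) i)).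

Lemma unit_discE (z : C) : unit_disc z <-> nrm z < 1.
Proof. by rewrite /unit_disc /= nrmE -toC1 toC_lt. Qed.

Definition disc_joined (x y : M) := exists (a b : C) (h : C -> M),
  [/\ unit_disc a /\ unit_disc b, holomorphic_disc h /\ tangential_disc D h, h a = x & h b = y].

Inductive disc_chain (x : M) : M -> Prop :=
| disc_chain_nil : disc_chain x x
| disc_chain_cons y z : disc_chain x y -> disc_joined y z -> disc_chain x z.

Lemma disc_joined_sym x y : disc_joined x y -> disc_joined y x.
Proof. by move=> [a [b [h [[? ?] ? ? ?]]]]; exists b, a, h. Qed.

Lemma disc_chain_trans x y z : disc_chain x y -> disc_chain y z -> disc_chain x z.
Proof.
by move=> xy; elim=> // y' z' _ IH j; exact: disc_chain_cons IH j.
Qed.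

Lemma disc_chain_sym x y : disc_chain x y -> disc_chain y x.
Proof.
elim=> [|y' z _ IH /disc_joined_sym j]; first exact: disc_chain_nil.
by apply: disc_chain_trans IH; apply: disc_chain_cons j; exact: disc_chain_nil.
Qed.

(** Every link of the chain contributes the Poincare distance of two points of the
unit disc. *)
Lemma disc_chain_finite x y : disc_chain x y -> (kobayashi_dist D x y < +oo)%E.
Proof.
move=> xy.
have [N [u [u0 uN hu]]] : exists N (u : nat -> M), [/\ u 0%N = x, u N = y &
    forall j, (j < N)%N -> disc_joined (u j) (u j.+1)].
  elim: xy => [|y' z _ [N [u [u0 uN hu]]] j]; first by exists 0%N, (fun=> x).
  exists N.+1, (fun k => if (k <= N)%N then u k else z); split => //.
    by rewrite ltnn.
  move=> k; rewrite ltnS => kN; rewrite kN; have [kN'|kN'] := ltnP k N; first exact: hu.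
  by have -> : k = N; [apply/eqP; rewrite eqn_leq kN kN' | rewrite uN].
apply: (@le_lt_trans _ _ (\sum_(0 <= j < N) disc_dist D (u j) (u j.+1))%E).
  by apply: ereal_inf_lbound; exists N, u.
rewrite big_mkord; apply: lte_sum_pinfty => j _.
have [a [b [h [hab hh ha hb]]]] := hu j (ltn_ord j).
apply: (@le_lt_trans _ _ (poincare_dist a b)%:E); last exact: ltry.
by apply: ereal_inf_lbound; exists a, b, h.
Qed.

Lemma lspan_map (V V' : lmodType C) (f : V -> V') (A : set V) (B : set V') v :
  (forall m (a : 'I_m -> C) (w : 'I_m -> V), f (\sum_(j < m) a j *: w j) = \sum_(j < m) a j
      *: f (w j)) ->
  (forall u, A u -> B (f u)) -> lspan A v -> lspan B (f v).
Proof.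
move=> hf AB [m [a [w [hw ->]]]]; exists m, a, (fun j => f (w j)); split; last exact: hf.
by move=> j; exact: AB.
Qed.

Lemma tvec_sumE (i : chart_index M) m (a : 'I_m -> C) (w : 'I_m -> tvec M) :
  (\sum_(j < m) a j *: w j) i = \sum_(j < m) a j *: w j i.
Proof. by rewrite fct_sumE. Qed.

Lemma near_chart i p : dom i p -> \forall z \near phi i p, dom i (psi i z) /\ phi i (psi i z) = z.
Proof.
move=> ip.
have h1 : \forall z \near phi i p, (phi i @` dom i) z.
  by apply: open_nbhs_nbhs; split; [exact: chart_image_open | exists p].
by apply: filterS h1 => z [q iq <-]; rewrite chart_mapK.
Qed.

(** The coordinates in the other charts are forced to be the images of w; the
chain rule for transition maps makes them compatible. *)
Lemma tangent_vector_exists i p (w : W) : dom i p -> exists2 v, tangent_space p v & v i = w.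
Proof.
move=> ip.
have dp k : dom k p -> differentiable (phi k \o psi i) (phi i p).
  by move=> kp; exact: transition_holomorphic.
exists (fun k => if p \in dom k then 'd (phi k \o psi i) (phi i p) w else 0); last first.
  rewrite mem_set //.
  have e : \forall z \near phi i p, id z = (phi i \o psi i) z.
    by apply: filterS (near_chart ip) => z [].
  have [_ E] := nrm_diff_ext e (diff_id (phi i p)).
  have [_ E2] := @diff_lin_id _ _ _ idfun (phi i p) (fun x => @cvg_id _ _).
  apply: etrans (congr1 (fun k : W -> W => k w) E) _.
  exact: (congr1 (fun k : W -> W => k w) E2).
split=> [k l kp lp|k kp]; last by rewrite memNset.
rewrite !mem_set //.
have pp : psi i (phi i p) = p by exact: chart_mapK.
have e : \forall z \near phi i p, ((phi l \o psi k) \o (phi k \o psi i)) z = (phi l \o psi i) z.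
  have c : {for phi i p, continuous (psi i)} by exact: chart_inv_continuous.
  have h : \forall q \near p, dom k q by apply: open_nbhs_nbhs; split => //; exact: chart_dom_open.
  have h' : \forall z \near phi i p, dom k (psi i z) by apply: (c (dom k)); rewrite pp.
  by near=> z; rewrite /= chart_mapK //; near: z.
have E0 : (phi k \o psi i) (phi i p) = phi k p by rewrite /= pp.
have d2 : differentiable (phi l \o psi k) ((phi k \o psi i) (phi i p)).
  by rewrite E0; exact: transition_holomorphic.
have [_ E] := nrm_diff_ext e (differentiable_comp (dp k kp) d2).
apply: etrans (congr1 (fun k : W -> W => k w) E) _.
apply: etrans (congr1 (fun k : W -> W => k w) (diff_comp (dp k kp) d2)) _.
by rewrite /= pp.
Unshelve. all: by end_near. Qed.

Section Chart.
Variables (p : M) (i : chart_index M) (U : set M) (X : 'I_(dist_rank D) -> vfield M).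
Hypotheses (ip : dom i p) (Up : U p) (frame : holomorphic_frame D U X).

Let O : set W := phi i @` (dom i `&` U).
Let Xc j := vfield_in_chart (X j) i.

Lemma chart_setP z : O z -> [/\ dom i (psi i z), U (psi i z) & phi i (psi i z) = z].
Proof. by move=> [q [iq Uq] <-]; rewrite chart_mapK. Qed.

Lemma chart_set_near z : O z -> \forall w \near z, O w.
Proof.
move=> Oz; have [iz Uz pz] := chart_setP Oz.
have [oU _ _ _] := frame.
have c : {for phi i (psi i z), continuous (psi i)} by exact: chart_inv_continuous.
have h : \forall q \near psi i z, U q by apply: open_nbhs_nbhs.
have h' : \forall w \near phi i (psi i z), U (psi i w) by apply: (c U); rewrite chart_mapK.
have h'' := near_chart iz; rewrite pz in h' h''.
near=> w; exists (psi i w); first split.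
- by have [] : dom i (psi i w) /\ phi i (psi i w) = w by near: w.
- by near: w.
- by have [] : dom i (psi i w) /\ phi i (psi i w) = w by near: w.
Unshelve. all: by end_near. Qed.

Lemma chart_set_open : open_nrm O.
Proof. by move=> z /chart_set_near /nbhs_nrm. Qed.

Lemma chart_field_hol j z : O z -> hol (Xc j) z.
Proof.
move=> /chart_set_open[r r0 hr]; exists r => // w /hr /chart_setP[iw Uw pw].
have [_ hX _ _] := frame; have [_ /(_ i iw)] := hX j _ Uw.
by rewrite pw.
Qed.

(** Brackets are computed from germs in the chart, and only the points of O matter. *)
Lemma chart_bracket Y : iterated_bracket X Y -> exists Y' : W -> W, bracket_field Xc Y' /\
  forall z, O z -> vfield_in_chart Y i z = Y' z.
Proof.
elim=> [j|{}Y Z _ [Y' [BY hY]] _ [Z' [BZ hZ]]].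
  by exists (Xc j); split => //; exact: bracket_field_gen.
exists (fun z => 'd Z' z (Y' z) - 'd Y' z (Z' z)); split; first exact: bracket_field_lie.
move=> z Oz; have [iz Uz pz] := chart_setP Oz.
have ext F F' : bracket_field Xc F' -> (forall w, O w -> vfield_in_chart F i w = F' w) ->
    'd (vfield_in_chart F i) z = 'd F' z :> (W -> W).
  move=> BF hF; have dF' : differentiable F' z.
    exact: hol_diff (bracket_field_hol chart_field_hol BF Oz).
  have e : \forall w \near z, F' w = vfield_in_chart F i w.
    by apply: filterS (chart_set_near Oz) => w /hF.
  by have [_] := nrm_diff_ext e dF'.
rewrite {1}/vfield_in_chart /lie_bracket mem_set //.
have eY : Y (psi i z) i = Y' z := hY z Oz.
have eZ : Z (psi i z) i = Z' z := hZ z Oz.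
apply: (f_equal2 (fun a b : W => a - b)).
  apply: etrans (congr1 ('d (vfield_in_chart Z i) (phi i (psi i z))) eY) _.
  apply: etrans (congr1 (fun q => 'd (vfield_in_chart Z i) q (Y' z)) pz) _.
  exact: (congr1 (fun k : W -> W => k (Y' z)) (ext _ _ BZ hZ)).
apply: etrans (congr1 ('d (vfield_in_chart Y i) (phi i (psi i z))) eZ) _.
apply: etrans (congr1 (fun q => 'd (vfield_in_chart Y i) q (Z' z)) pz) _.
exact: (congr1 (fun k : W -> W => k (Z' z)) (ext _ _ BY hY)).
Qed.

Lemma chart_spanning z w : bracket_generating D -> O z ->
  lspan [set Y z | Y in bracket_field Xc] w.
Proof.
move=> gen Oz; have [iz Uz pz] := chart_setP Oz.
have [v tv <-] := tangent_vector_exists w iz.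
apply: (@lspan_map _ _ (fun v : tvec M => v i) _ _ v _ _ (gen _ _ frame _ Uz _ tv)).
  by move=> m a u; rewrite tvec_sumE.
move=> u [Y /chart_bracket[Y' [BY hY]] <-]; exists Y' => //.
by rewrite -hY.
Qed.

(** Rescaled to the unit disc, an integral curve of X_j in the chart is a tangential
disc: its differential is a multiple of X_j in the chart i, hence in all charts
because X_j is a tangent vector. *)
Lemma chart_disc j (g : C -> W) (T : R) :
  (forall t, nrm t < T -> [/\ O (g t), differentiable g t & 'd g t 1 = Xc j (g t)]) ->
  forall t, nrm t < T -> disc_chain (psi i (g 0)) (psi i (g t)).
Proof.
move=> hg t ht.
have T0 : 0 < T by apply: le_lt_trans (nrm_ge0 t) ht.
have Tn : toC T != 0 by rewrite toC_eq0 gt_eqF.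
have sc z : unit_disc z -> nrm (toC T * z) < T.
  by move=> /unit_discE hz; rewrite nrmM nrm_toC gtr0_norm // gtr_pMr.
pose gT (z : C) := g (toC T * z).
pose h (z : C) : M := psi i (gT z).
have gTd z : unit_disc z -> differentiable gT z /\
    forall w, 'd gT z w = (w * toC T) *: Xc j (gT z).
  move=> /sc hz; have [_ dg eg] := hg _ hz.
  have [l lE] : exists L : {linear C -> C}, L =1 (fun z => toC T * z).
    by apply: linear_of => [x y|a x]; rewrite ?mulrDr // [a *: x]/(a * x) mulrCA.
  have lF : (fun z => toC T * z) = l by apply/funext => u; rewrite lE.
  have cl : continuous l.
    by apply: (@bound_continuous _ _ _ l (nrm (toC T))) => x; rewrite lE nrmM.
  have [d1 e1] := diff_lin_id z cl.
  have gE : gT = g \o l by apply/funext => u; rewrite /gT /= lE.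
  have lz : l z = toC T * z := lE z.
  have d2 : differentiable g (l z) by rewrite lz; exact: dg.
  split; first by rewrite gE; exact: (differentiable_comp d1 d2).
  move=> w; rewrite gE; apply: etrans (congr1 (fun k : C -> W => k w) (diff_comp d1 d2)) _.
  have e2 : 'd l z w = w * toC T.
    by apply: etrans (congr1 (fun k : C -> C => k w) e1) _; rewrite lE mulrC.
  apply: etrans (congr1 ('d g (l z)) e2) _; apply: etrans (diff1 _ _ _) _.
  by congr (_ *: _); apply: etrans (congr1 (fun u => 'd g u 1) lz) _;
    exact: (etrans eg (congr1 (fun u => Xc j (g u)) (esym lz))).
have hO z : unit_disc z -> O (gT z) by move=> /sc /hg[].
have hd z k : unit_disc z -> dom k (h z) -> differentiable (phi k \o h) z /\
    forall w, 'd (phi k \o h) z w = (w * toC T) *: X j (h z) k.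
  move=> uz kz; have [iz Uz pz] := chart_setP (hO z uz).
  have [d1 e1] := gTd z uz.
  have d2 : differentiable (phi k \o psi i) (gT z).
    by rewrite -pz; exact: transition_holomorphic.
  split; first exact: (differentiable_comp d1 d2).
  move=> w; apply: etrans (congr1 (fun k : C -> W => k w) (diff_comp d1 d2)) _.
  apply: etrans (congr1 ('d (phi k \o psi i) (gT z)) (e1 w)) _.
  apply: etrans (linearZ _ _) _; congr (_ *: _).
  have [_ hX _ _] := frame; have [[tX _] _] := hX j _ Uz.
  by rewrite (tX i k iz kz) pz.
have hcurve : holomorphic_disc h /\ tangential_disc D h.
  split=> z uz.
    have [iz Uz pz] := chart_setP (hO z uz).
    split; last by move=> k kz; exact: (hd z k uz kz).1.
    apply: (@continuous_comp _ _ _ gT (psi i) z).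
      exact: differentiable_continuous (gTd z uz).1.
    by have := chart_inv_continuous iz; rewrite pz.
  move=> w; have [iz Uz pz] := chart_setP (hO z uz).
  have [_ hX _ ->] := frame; last exact: Uz.
  exists 1%N, (fun=> w * toC T), (fun=> X j (h z)); split; first by move=> _; exists j.
  rewrite big_ord_recl big_ord0 addr0; apply/funext => k.
  rewrite /disc_differential; case: ifPn => [|nk].
    by rewrite inE => kz; exact: (hd z k uz kz).2.
  have [[_ tX] _] := hX j _ Uz; rewrite notin_setE in nk.
  by have := tX k nk; rewrite /h => e; rewrite [RHS](_ : _ = (w * toC T) *: X j (psi i (gT
      z)) k) // e scaler0.
apply: disc_chain_cons (disc_chain_nil _) _.
exists 0, (t / toC T), h; split => //.
- split; apply/unit_discE; first by rewrite nrm0.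
  by rewrite nrmM nrmV nrm_toC gtr0_norm // ltr_pdivrMr // mul1r.
- by rewrite /h /gT mulr0.
- by rewrite /h /gT mulrCA mulfV // mulr1.
Qed.

Lemma chart_chain_near : bracket_generating D -> \forall q \near p, disc_chain q p.
Proof.
move=> gen.
have Op : O (phi i p) by exists p.
have [r r0 hr] := @local_chow R n _ O Xc (fun z w => disc_chain (psi i z) (psi i w))
  chart_set_open chart_field_hol (fun x => disc_chain_nil _) (fun x y => @disc_chain_sym _ _)
  (fun x y z => @disc_chain_trans _ _ _) chart_disc (fun z w => chart_spanning w gen) _ Op.
have h1 : \forall q \near p, dom i q by apply: open_nbhs_nbhs; split => //; exact: chart_dom_open.
have h2 : \forall q \near p, nrm (phi i q - phi i p) < r.
  have c : {for p, continuous (phi i)} by exact: chart_map_continuous.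
  by apply: (c [set z | nrm (z - phi i p) < r]); apply/nbhs_nrm; exists r.
near=> q; have iq : dom i q by near: q.
have := hr (phi i q); rewrite !chart_mapK //; apply; by near: q.
Unshelve. all: by end_near. Qed.

End Chart.

Lemma chain_near p : bracket_generating D -> \forall q \near p, disc_chain q p.
Proof.
move=> gen; have [i ip] := atlas_cover p.
have [U [X [Up fr]]] := dist_frame D p.
exact: chart_chain_near ip Up fr gen.
Qed.

End Manifold.

(** The class of x is open, and so is its complement, which is a union of classes. *)
Theorem theorem1p2 (R : realType) (n : nat) (M : complexManifold R n)
    (D : holoDistribution M) :
  connected [set: M]%classic ->
  bracket_generating D ->
  forall x y : M, (kobayashi_dist D x y < +oo)%E.
Proof.
move=> cM gen x y; apply: disc_chain_finite.
have o : open [set z | disc_chain D x z].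
  rewrite openE => z /= xz; apply: filterS (chain_near z gen) => q /disc_chain_sym.
  exact: disc_chain_trans.
have c : closed [set z | disc_chain D x z].
  rewrite -openC openE => z /= xz; apply: filterS (chain_near z gen) => q qz xq.
  by apply: xz; exact: disc_chain_trans xq qz.
suff e : [set z | disc_chain D x z] = [set: M] by have : [set: M] y by []; rewrite -e.
apply: cM.
- by exists x; exact: disc_chain_nil.
- by exists [set z | disc_chain D x z] => //; rewrite setTI.
- by exists [set z | disc_chain D x z] => //; rewrite setTI.
Qed.
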